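(* Let $C$ and $C'$ be tropical curves of genus $g$. Then $t_g^{\rm tr}(C)=t_g^{\rm tr}(C')$ (i.e. $\operatorname{Jac}(C)\cong\operatorname{Jac}(C')$) if and only if $[C^3]_2=[C'^3]_2$. In particular, $t_g^{\rm tr}$ is injective on the locus of tropical curves whose underlying graph is $3$-connected.
   Context: A tropical curve of genus $g$ is $C=(\Gamma,w,l)$: $\Gamma$ a finite connected graph (loops, multiple edges allowed), $w:V(\Gamma)\to\mathbb{Z}_{\ge0}$ with every weight-$0$ vertex of valence $\ge3$, $b_1(\Gamma)+|w|=g$ where $|w|=\sum_vw(v)$, and $l:E(\Gamma)\to\mathbb{R}_{>0}$. Its Jacobian $\operatorname{Jac}(C)$ is the real torus $(H_1(\Gamma,\mathbb{R})\oplus\mathbb{R}^{|w|})/(H_1(\Gamma,\mathbb{Z})\oplus\mathbb{Z}^{|w|})$ (with $H_1(\Gamma,\mathbb{Z})$ the kernel of the boundary map for a fixed orientation) with the positive semi-definite quadratic form $Q_C$ vanishing on $\mathbb{R}^{|w|}$ and equal to $\sum_e\alpha_e^2l(e)$ on $\sum_e\alpha_ee\in H_1(\Gamma,\mathbb{R})$; two such tori $(\mathbb{R}^g/\Lambda,Q)$, $(\mathbb{R}^g/\Lambda',Q')$ are isomorphic if some $h\in\mathrm{GL}_g(\mathbb{R})$ has $h(\Lambda)=\Lambda'$ and $hQh^t=Q'$; $t_g^{\rm tr}(C)$ is the isomorphism class of $\operatorname{Jac}(C)$. A cycle of $\Gamma$ is the edge set of a closed simple circuit. A separating edge is one whose removal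 disconnects $\Gamma$. A C1-set is a maximal set of non-separating edges lying in exactly the same cycles (the C1-sets partition the non-separating edges). A $3$-edge-connectivization $C^3=(\Gamma^3,w^3,l^3)$ of $C$: $\Gamma^3$ is obtained from $\Gamma$ by contracting all separating edges and, for each C1-set $S$, all edges of $S$ but one, call it $e_S$; $w^3$ is induced by the contraction rule (contracting a loop at $v$ adds $1$ to $w(v)$; contracting an edge between distinct $v_1,v_2$ gives a vertex of weight $w(v_1)+w(v_2)$); $l^3(e_S)=\sum_{e\in S}l(e)$. Two tropical curves $(\Gamma,w,l)$, $(\Gamma',w',l')$ are $2$-isomorphic if there is a bijection $E(\Gamma)\to E(\Gamma')$ preserving lengths and inducing a bijection between cycles of $\Gamma$ and of $\Gamma'$; $[C^3]_2$ is the $2$-isomorphism class of $C^3$, which does not depend on the choices made. A graph is $3$-connected if it stays connected after removing any two vertices (with their incident edges).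
   Formalization: In the ''in particular'' clause, injectivity is proved for 3-connected curves without loops and with all vertex weights zero; as stated it fails, e.g. for K_4 with generic lengths and weight 1 (or a loop) placed at different vertices. The main equivalence is unchanged. *)

(* Defs.v *)
From Stdlib Require Import Reals ClassicalEpsilon.
From mathcomp Require Import all_boot.

Set Implicit Arguments.
Unset Strict Implicit.
Unset Printing Implicit Defensive.

Definition pbool (P : Prop) : bool :=
  if excluded_middle_informative P then true else false.

(* Raw data of a (weighted, metric) graph: vertices, edges, a fixed
   orientation src -> tgt of every edge (loops: src = tgt), weights, lengths. *)
Record tgraph := TGraph {
  tV : finType;
  tE : finType;
  tsrc : tE -> tV;
  ttgt : tE -> tV;
  tw : tV -> nat;
  tl : tE -> R }.
Arguments tsrc : clear implicits.
Arguments ttgt : clear implicits.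
Arguments tw : clear implicits.
Arguments tl : clear implicits.

Section Graphs.
Variable C : tgraph.

Definition joins (e : tE C) (a b : tV C) : bool :=
  ((tsrc C e == a) && (ttgt C e == b)) || ((tsrc C e == b) && (ttgt C e == a)).

Definition adj_in (P : pred (tE C)) (Vok : pred (tV C)) : rel (tV C) :=
  fun a b => [&& Vok a, Vok b & [exists e, P e && joins e a b]].

(* the subgraph (edges P, vertices Vok) is connected (the empty graph counts as connected) *)
Definition connected_on (P : pred (tE C)) (Vok : pred (tV C)) : Prop :=
  forall a b, Vok a -> Vok b -> connect (adj_in P Vok) a b.

Definition graph_connected : Prop :=
  (0 < #|tV C|)%N /\ connected_on predT predT.

(* valence: a loop counts twice *)
Definition valence (v : tV C) : nat :=
  (#|[set e | tsrc C e == v]| + #|[set e | ttgt C e == v]|)%N.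

Definition totw : nat := (\sum_(v : tV C) tw C v)%N.

(* first Betti number of a connected graph *)
Definition b1 : nat := (#|tE C| + 1 - #|tV C|)%N.

(* a cycle: edge set of a closed simple circuit v_0 e_1 v_1 ... e_k v_0 (k >= 1),
   with distinct vertices and distinct edges *)
Definition is_cycle (S : {set tE C}) : Prop :=
  exists (vs : seq (tV C)) (es : seq (tE C)),
    [/\ (0 < size es)%N /\ size vs = size es, uniq vs, uniq es,
        S = [set e in es] &
        forall x, x \in zip es (zip vs (rot 1 vs)) -> joins x.1 x.2.1 x.2.2].

Definition separating (e : tE C) : Prop :=
  ~ connected_on (predC1 e) predT.

Definition same_cycles (e f : tE C) : Prop :=
  forall S, is_cycle S -> (e \in S <-> f \in S).

(* Rp picks exactly one edge e_S in each C1-set S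
   (C1-sets = classes of non-separating edges under same_cycles) *)
Definition is_rep (Rp : {set tE C}) : Prop :=
  [/\ forall e, e \in Rp -> ~ separating e,
      forall e, ~ separating e -> exists2 f, f \in Rp & same_cycles e f &
      forall e f, e \in Rp -> f \in Rp -> same_cycles e f -> e = f].

Definition three_connected : Prop :=
  forall x y : tV C, x != y -> connected_on predT (fun v => (v != x) && (v != y)).

Definition loopless : Prop := forall e : tE C, tsrc C e != ttgt C e.

Definition jcoord : finType := (tE C + 'I_totw)%type.
Definition jvec := jcoord -> R.

(* the subspace H_1(Gamma,R) (+) R^{|w|}: kernel of the boundary map de = tgt e - src e *)
Definition inH1 (x : jvec) : Prop :=
  forall v : tV C,
    Rminus (\big[Rplus/R0]_(e : tE C | ttgt C e == v) x (inl e))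
           (\big[Rplus/R0]_(e : tE C | tsrc C e == v) x (inl e)) = R0.

Definition inLat (x : jvec) : Prop := forall j, exists z : Z, x j = IZR z.

Definition Qform (x : jvec) : R :=
  \big[Rplus/R0]_(e : tE C) Rmult (Rmult (x (inl e)) (x (inl e))) (tl C e).

End Graphs.

Definition is_tcurve (g : nat) (C : tgraph) : Prop :=
  [/\ graph_connected C,
      forall v : tV C, tw C v = 0%N -> (3 <= valence v)%N,
      (b1 C + totw C)%N = g &
      forall e : tE C, Rlt R0 (tl C e)].

Definition vadd (T : Type) (x y : T -> R) : T -> R := fun t => Rplus (x t) (y t).
Definition vscale (T : Type) (c : R) (x : T -> R) : T -> R := fun t => Rmult c (x t).

Definition jac_iso (C C' : tgraph) : Prop :=
  exists h : jvec C -> jvec C',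
    [/\ (forall x y, inH1 x -> inH1 y -> h (vadd x y) = vadd (h x) (h y)) /\
        (forall c x, inH1 x -> h (vscale c x) = vscale c (h x)),
        forall x, inH1 x -> inH1 (h x),
        (forall x y, inH1 x -> inH1 y -> h x = h y -> x = y) /\
        (forall y, inH1 y -> exists2 x, inH1 x & h x = y),
        forall x, inH1 x -> (inLat x <-> inLat (h x)) &
        forall x, inH1 x -> Qform (h x) = Qform x].

Definition two_iso (D D' : tgraph) : Prop :=
  exists phi : tE D -> tE D',
    [/\ bijective phi,
        forall e, tl D' (phi e) = tl D e,
        forall S, is_cycle S -> is_cycle (phi @: S) &
        forall S', is_cycle S' -> exists2 S, is_cycle S & phi @: S = S'].

Definition tc_iso (C C' : tgraph) : Prop :=
  exists (sigma : tV C -> tV C') (phi : tE C -> tE C'),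
    [/\ bijective sigma, bijective phi,
        forall e, joins (phi e) (sigma (tsrc C e)) (sigma (ttgt C e)),
        forall v, tw C' (sigma v) = tw C v &
        forall e, tl C' (phi e) = tl C e].

Section Conn3.
Variables (C : tgraph) (Rp : {set tE C}).

(* contracted edges: all separating edges and, in each C1-set, all but e_S *)
Definition contracted : pred (tE C) := fun e => e \notin Rp.
Definition cadj : rel (tV C) := adj_in contracted predT.

Lemma cadj_sym : symmetric cadj.
Proof.
move=> a b; rewrite /cadj /adj_in /=.
apply/existsP/existsP=> -[e He]; exists e; move: He; rewrite /joins.
  by rewrite [X in _ && X]orbC.
by rewrite [X in _ && X]orbC.
Qed.

Definition croot (v : tV C) : tV C := root cadj v.

Lemma croot_root v : croot (croot v) == croot v.
Proof. by rewrite /croot root_root //; apply: sym_connect_sym; exact: cadj_sym. Qed.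

(* vertices of Gamma^3: the classes of the contraction, represented by roots *)
Definition V3 : finType := {v : tV C | croot v == v}.
Definition to3 (v : tV C) : V3 := exist _ (croot v) (croot_root v).
Definition E3 : finType := {e : tE C | e \in Rp}.

Definition src3 (e : E3) : V3 := to3 (tsrc C (val e)).
Definition tgt3 (e : E3) : V3 := to3 (ttgt C (val e)).

(* weight obtained by the contraction rule: total weight of the class plus
   the number of loops created, i.e. b_1 of the contracted subgraph of the class *)
Definition w3 (r : V3) : nat :=
  ((\sum_(v : tV C | croot v == val r) tw C v) +
   (#|[set e | contracted e && (croot (tsrc C e) == val r)]| + 1
      - #|[set v | croot v == val r]|))%N.

Definition l3 (e : E3) : R :=
  \big[Rplus/R0]_(f : tE C | pbool (~ separating f /\ same_cycles (val e) f)) tl C f.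

Definition conn3 : tgraph := @TGraph V3 E3 src3 tgt3 w3 l3.

End Conn3.

(* Main.v *)
Require Import Defs.
From Stdlib Require Import Reals ClassicalEpsilon.
From mathcomp Require Import all_boot all_order all_algebra.
From mathcomp Require Import boolp Rstruct lra ring zify.

Set Implicit Arguments.
Unset Strict Implicit.
Unset Printing Implicit Defensive.
Import Order.TTheory GRing.Theory Num.Theory.
Local Open Scope ring_scope.

(** Every flow [x] is a nonnegative combination of signed cycles that agree in sign with [x]
    (flow spaces are unimodular), and cycles are the minimal supports of flows.

    If [Q] is the length form, [\sum_e l(e) |x_e|] is the minimum of [\sum_i c_i Q(g_i)] over the
    expressions [x = \sum_i c_i g_i] with [c_i >= 0] and [g_i] in the lattice of integral flows, so
    an isometry of Jacobians preserves this weighted 1-norm. The norm has kinks exactly along the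
    hyperplanes [x_e = 0], and the size of the kink is the total length of the C1-set of [e]; hence
    the isometry permutes the coordinates indexed by the C1-sets, up to sign, and preserves the
    lengths of the 3-edge-connectivizations.

    Conversely, a unimodular space is determined by its circuits up to changing the signs of
    coordinates: in the matrix of fundamental circuits, a chordless alternating chain fixes the sign
    of the entry closing it. Hence a 2-isomorphism lifts to an isometry of Jacobians.

    In a 3-connected graph every C1-set is a single edge. When [G - v] is connected, the
    star of [v] corresponds to a cut of [G'] whose complement is a connected matroid, which forces
    one side of the cut to be a single vertex; this recovers the vertices. *)

(** * Unimodular spaces *)

(** Two facts make the weighted norm an invariant. On integers [|a| <= a^2], with equality for 0, 1
    and -1, so on the lattice [Q] dominates the norm and agrees with it on signed cycles; and a
    conformal decomposition adds norms without cancellation.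

    An isometry need not respect the splitting into flows and weight coordinates. A vector without
    edge part has zero form, and since lengths are positive its image has no edge part either; this
    is why edge coordinates alone can be compared. In the converse direction the weight coordinates
    are matched by number: the flow spaces have equal dimension, and equal genus gives equal total
    weight.

    Cycles enter only as minimal supports of flows. Separating edges, C1-sets and cuts then become
    statements about linear functionals on flows.

    The definition of 3-connectedness admits a path on three vertices with multiple edges, whose
    middle vertex cuts. One vertex is therefore exempt from the star argument and recovered by
    counting: zero weights and equal genus force equal numbers of vertices. *)

Lemma pboolP (P : Prop) : reflect P (pbool P).
Proof. by rewrite /pbool; case: excluded_middle_informative => h; constructor. Qed.

Section Space.
Variables (F : realFieldType) (E : finType).
Implicit Types (x y d : E -> F) (L : (E -> F) -> Prop) (S T : {set E}).

Definition lin_closed L :=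
  L (fun=> 0) /\ forall x y c, L x -> L y -> L (fun e => x e + c * y e).

Definition supp x : {set E} := [set e | x e != 0].

Definition sign1 (a : F) := a = 1 \/ a = -1.
Definition signvec d := forall e, d e = 0 \/ sign1 (d e).

Definition circuit L S :=
  [/\ exists2 x, L x & supp x = S, S != set0 &
      forall y, L y -> supp y \subset S -> supp y = set0 \/ supp y = S].

Definition conformal d x := forall e, d e != 0 -> 0 < d e * x e.

(** Representations of regular matroids, expressed without determinants: below every nonzero vector
    there is a conformal circuit vector with entries 0, 1, -1. For flows this vector is a directed
    circuit. *)
Definition unimodular L :=
  lin_closed L /\
  forall x, L x -> supp x != set0 ->
    exists d, [/\ L d, signvec d, circuit L (supp d) & conformal d x].

Lemma sign1_sqr a : sign1 a -> a * a = 1.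
Proof. by case=> ->; rewrite ?mulr1 // mulrNN mulr1. Qed.

Lemma sign1_neq0 a : sign1 a -> a != 0.
Proof. by case=> ->; rewrite ?oppr_eq0 oner_neq0. Qed.

Lemma sign1M a b : sign1 a -> sign1 b -> sign1 (a * b).
Proof. by move=> [] -> [] ->; rewrite ?mulr1 ?mul1r ?mulrNN ?mulr1; [left|right|right|left]. Qed.

Lemma sign1N a : sign1 a -> sign1 (- a).
Proof. by case=> ->; rewrite ?opprK; [right|left]. Qed.

Lemma signvec_neq0 d e : signvec d -> d e != 0 -> sign1 (d e).
Proof. by move=> /(_ e) [->|//]; rewrite eqxx. Qed.

Lemma supp0 x : supp x = set0 -> x = fun=> 0.
Proof.
by move=> h; apply/funext=> e; apply/eqP/negPn; have := in_set0 e; rewrite -h inE => ->.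
Qed.

Lemma lin_closedD L x y c :
  lin_closed L -> L x -> L y -> L (fun e => x e + c * y e).
Proof. by case=> _; apply. Qed.

Lemma lin_closedZ L x c : lin_closed L -> L x -> L (fun e => c * x e).
Proof.
move=> [L0 LD] Lx; have := LD _ _ c L0 Lx.
by congr L; apply/funext=> e; rewrite add0r.
Qed.

Lemma lin_closed_sum L (I : Type) (r : seq I) (P : pred I) (c : I -> F)
    (g : I -> E -> F) :
  lin_closed L -> (forall i, P i -> L (g i)) ->
  L (fun e => \sum_(i <- r | P i) c i * g i e).
Proof.
move=> LL Lg; elim: r => [|i r IH].
  by have := LL.1; congr L; apply/funext=> e; rewrite big_nil.
case Pi: (P i); last by move: IH; congr L; apply/funext=> e; rewrite big_cons Pi.
have := lin_closedD (c i) LL IH (Lg _ Pi).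
by congr L; apply/funext=> e; rewrite big_cons Pi addrC.
Qed.

Lemma circuit_vec L S : unimodular L -> circuit L S ->
  exists d, [/\ L d, signvec d & supp d = S].
Proof.
move=> [LL U] [[x Lx <-] S0 Smin]; have [d [Ld sd [_ d0 _] cd]] := U x Lx S0.
exists d; split=> //; have [] := Smin d Ld; last by [].
  apply/subsetP=> e; rewrite !inE => de; have := cd e de.
  by apply: contraTneq => ->; rewrite mulr0 ltxx.
by move=> h; rewrite h eqxx in d0.
Qed.

Lemma conformal_supp d x : conformal d x -> supp d \subset supp x.
Proof.
move=> cd; apply/subsetP=> e; rewrite !inE => de; have := cd e de.
by apply: contraTneq => ->; rewrite mulr0 ltxx.
Qed.

(* Subtract the largest multiple of a conformal circuit vector that keeps all signs;
   the support shrinks. *)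
Lemma conformal_ind L (P : (E -> F) -> Prop) : unimodular L ->
  P (fun=> 0) ->
  (forall x d c, L x -> L d -> signvec d -> circuit L (supp d) -> 0 < c ->
     (forall e, 0 <= x e * d e) -> P x -> P (fun e => x e + c * d e)) ->
  forall x, L x -> P x.
Proof.
move=> [LL U] P0 PS x; move: {2}#|supp x| (leqnn #|supp x|) => n.
elim: n x => [|n IH] x.
  by rewrite leqn0 cards_eq0 => /eqP /supp0 ->.
move=> sx Lx; have [/supp0->//|x0] := eqVneq (supp x) set0.
have [d [Ld sd Cd cd]] := U x Lx x0.
have /set0Pn [e0 e0d] : supp d != set0 by case: Cd.
case: (Order.TotalTheory.arg_minP (fun e => `|x e|) e0d) => e1 e1d emin.
have d1 : d e1 != 0 by have : e1 \in supp d := e1d; rewrite inE.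
have x1 : x e1 != 0 by have := cd _ d1; apply: contraTneq => ->; rewrite mulr0 ltxx.
pose c := `|x e1|; have c0 : 0 < c by rewrite normr_gt0.
have dx e : d e != 0 -> x e * d e = `|x e|.
  move=> de; have := cd e de; have [->|->] := signvec_neq0 sd de.
    by rewrite mul1r mulr1 => h; rewrite gtr0_norm.
  by rewrite mulN1r mulrN1 oppr_gt0 => h; rewrite ltr0_norm.
pose y e := x e + (- c) * d e.
have Ly : L y by apply: lin_closedD.
have -> : x = fun e => y e + c * d e by apply/funext=> e; rewrite /y mulNr subrK.
have ysub : supp y \proper supp x.
  apply/properP; split.
    apply/subsetP=> e; rewrite !inE /y; apply: contraNneq => xe.
    have [->|de] := eqVneq (d e) 0; first by rewrite xe mulr0 addr0.
    by have := cd _ de; rewrite xe mulr0 ltxx.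
  exists e1; rewrite !inE // negbK /y mulNr subr_eq0 /c -(dx _ d1) -mulrA.
  by rewrite (sign1_sqr (signvec_neq0 sd d1)) mulr1.
apply: PS => //.
  move=> e; have [->|de] := eqVneq (d e) 0; first by rewrite mulr0.
  rewrite /y mulrDl (dx _ de) -mulrA (sign1_sqr (signvec_neq0 sd de)) mulr1 subr_ge0.
  by have /emin : e \in supp d by rewrite inE.
by apply: IH => //; rewrite -ltnS; apply: leq_trans sx; apply: proper_card.
Qed.

(** The terms of a conformal decomposition never cancel, so a term using [e] is conformal to the
    whole sum, and some term uses [e]. *)
Lemma circuit_through L x e : unimodular L -> L x -> x e != 0 ->
  exists d, [/\ L d, signvec d, circuit L (supp d), conformal d x & d e != 0].
Proof.
move=> UL Lx; move: x Lx e; apply: conformal_ind UL _ _ => [e|]; first by rewrite eqxx.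
move=> x d c Lx Ld sd Cd c0 xd IH e xe.
have [de|de] := eqVneq (d e) 0; last first.
  exists d; split=> // f df; rewrite mulrDr mulrCA (sign1_sqr (signvec_neq0 sd df)).
  by rewrite mulr1 ltr_wpDl // mulrC.
have [|d' [Ld' sd' Cd' cd' de']] := IH e; first by move: xe; rewrite de mulr0 addr0.
exists d'; split=> // f df; have := cd' f df; have := xd f.
have [->|df'] := eqVneq (d f) 0; first by rewrite !mulr0 addr0.
have [->|->] := signvec_neq0 sd' df; have [->|->] := signvec_neq0 sd df'; lra.
Qed.

End Space.

(** * Fundamental circuits of a basis *)

Section Basis.
Variables (F : realFieldType) (E : finType) (L : (E -> F) -> Prop) (T : {set E}).
Hypothesis UL : unimodular L.

(* [g i] is the fundamental circuit of [i] with respect to the basis [T]. *)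
Definition fundamental (g : E -> E -> F) :=
  forall i, i \notin T ->
    [/\ L (g i), signvec (g i), g i i = 1 & supp (g i) \subset i |: T].

Hypothesis Tfree : forall S : {set E}, S \subset T -> ~ circuit L S.

Lemma free_eq0 x : L x -> supp x \subset T -> x = fun=> 0.
Proof.
move=> Lx xT; apply: supp0; apply/eqP/negPn/negP=> x0.
have [d [_ _ Cd /conformal_supp sd]] := UL.2 x Lx x0.
exact: Tfree (subset_trans sd xT) Cd.
Qed.

Variable g : E -> E -> F.
Hypothesis gP : fundamental g.

Lemma fund_off i k : i \notin T -> k \notin T -> g i k = (i == k)%:R.
Proof.
move=> iT kT; have [_ _ g1 /subsetP sg] := gP iT.
have [<-|ik] := eqVneq i k; first by [].
apply/eqP/negPn/negP=> h; have := sg k; rewrite !inE h => /(_ isT).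
by rewrite (negPf kT) orbF eq_sym (negPf ik).
Qed.

(** Both sides agree outside [T], so their difference is supported in a set that contains no
    circuit. *)
Lemma fund_expand x e : L x -> x e = \sum_(i | i \notin T) x i * g i e.
Proof.
move=> Lx; pose z e := x e + (-1) * \sum_(i | i \notin T) x i * g i e.
suff : z = fun=> 0.
  by move=> /(congr1 (fun f => f e)); rewrite /z mulN1r => /subr0_eq.
apply: free_eq0.
  by apply: lin_closedD UL.1 Lx _; apply: lin_closed_sum UL.1 _ => i iT; have [] := gP iT.
apply/subsetP=> k; rewrite inE; apply: contraR => kT.
rewrite /z (bigD1 k) //= fund_off // eqxx mulr1 big1 ?addr0 ?mulN1r ?subrr //.
by move=> i /andP [iT ik]; rewrite fund_off // (negPf ik) mulr0.
Qed.

(* The alternating sum [y] along the chain would be a nonzero multiple of a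
   {0,1,-1}-vector with entries 1 (at [i]) and 2 (at [r n]) unless it vanishes at [r n]. *)
Lemma chordless_chain i n (r j : nat -> E) :
  i \notin T -> (0 < n)%N -> (forall q, (q < n)%N -> j q \notin T /\ j q != i) ->
  (forall q m, (q < n)%N -> (m <= n)%N -> (g (j q) (r m) != 0) = (m == q) || (m == q.+1)) ->
  (forall m, (m <= n)%N -> (g i (r m) != 0) = (m == 0%N) || (m == n)) ->
  g i (r n) = - (g i (r 0%N) * \prod_(q < n) - (g (j q) (r q.+1) * g (j q) (r q))).
Proof.
move=> iT n0 jT jr ir.
pose K m := \prod_(q < m) - (g (j q) (r q.+1) * g (j q) (r q)).
pose a m := g i (r 0%N) * K m.
have sj q m : (q < n)%N -> (m == q) || (m == q.+1) -> sign1 (g (j q) (r m)).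
  move=> qn mq; have [jqT _] := jT q qn; have [_ sg _ _] := gP jqT.
  by apply: signvec_neq0 => //; rewrite jr //; case/orP: mq => /eqP -> //; apply: ltnW.
have si m : (m <= n)%N -> (m == 0%N) || (m == n) -> sign1 (g i (r m)).
  by move=> mn mq; have [_ sg _ _] := gP iT; apply: signvec_neq0 => //; rewrite ir.
have sK m : (m <= n)%N -> sign1 (K m).
  elim: m => [|m IH] mn; first by rewrite /K big_ord0; left.
  rewrite /K big_ord_recr /=; apply: sign1M; first exact/IH/ltnW.
  by apply/sign1N/sign1M; apply: sj; rewrite ?eqxx ?orbT.
have sa m : (m <= n)%N -> sign1 (a m).
  by move=> mn; apply: sign1M; [apply: si|apply: sK].
have aS m : (m < n)%N -> a m.+1 = - (a m * (g (j m) (r m.+1) * g (j m) (r m))).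
  by move=> _; rewrite /a /K big_ord_recr /=; ring.
(* [a q] is the value that row [i] and the rows [j 0], ..., [j (q-1)] leave at [r q] for [q < n];
   the coefficient [c q] cancels it and passes [a q.+1] on to the next column. *)
pose c q := - (a q * g (j q) (r q)).
pose y e := g i e + 1 * \sum_(q < n) c q * g (j q) e.
have Ly : L y.
  have [Lg _ _ _] := gP iT.
  apply: lin_closedD UL.1 Lg _; apply: lin_closed_sum UL.1 _ => q _.
  by have [jqT _] := jT q (ltn_ord q); have [] := gP jqT.
have ysum m : (m < n)%N -> y (r m) = 0.
  move=> mn; rewrite /y mul1r (bigD1 (Ordinal mn)) //=.
  have cm : c m * g (j m) (r m) = - a m.
    by rewrite /c mulNr -mulrA sign1_sqr ?mulr1 //; apply: sj; rewrite ?eqxx.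
  rewrite cm; case: m mn cm => [|m] mn cm.
    rewrite big1 ?addr0 => [|q]; first by rewrite /a /K big_ord0 mulr1 subrr.
    rewrite -val_eqE /= => q0; apply/eqP; rewrite mulf_eq0; apply/orP; right.
    by apply/negPn; rewrite jr //; rewrite negb_or eq_sym q0.
  have mn' := ltnW mn; have := ir m.+1 mn'; rewrite (ltn_eqF mn) /= => /negbFE/eqP ->.
  rewrite (bigD1 (Ordinal mn')) /=; last by rewrite -val_eqE /= (ltn_eqF (ltnSn m)).
  rewrite big1 ?addr0 => [|q].
    rewrite /c aS // mulNr; ring.
  rewrite -!val_eqE /= => /andP [q1 q2]; apply/eqP; rewrite mulf_eq0; apply/orP; right.
  by apply/negPn; rewrite jr ?(ltnW mn) // negb_or eq_sym q1 eqSS eq_sym q2.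
have yn : y (r n) = g i (r n) + a n.
  rewrite /y mul1r; clear y Ly ysum; case: n n0 jT jr ir sj si sK sa aS => // n n0 jT jr ir sj si sK sa aS.
  rewrite big_ord_recr /= big1 ?add0r.
    by rewrite /c aS // mulNr -mulrA [g (j n) (r n) * _]mulrC.
  move=> q _; apply/eqP; rewrite mulf_eq0; apply/orP; right.
  by apply/negPn; rewrite jr //= ?(leq_trans (ltn_ord q)) //; have := ltn_ord q; lia.
have yi : y i = 1.
  rewrite /y mul1r; have [_ _ -> _] := gP iT; rewrite big1 ?addr0 // => q _.
  have [jqT jqi] := jT q (ltn_ord q).
  by rewrite fund_off // (negPf jqi) mulr0.
suff : y (r n) = 0 by rewrite yn => /eqP; rewrite addr_eq0 => /eqP.
apply/eqP/negPn/negP=> ynz.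
have s0 : supp y != set0 by apply/set0Pn; exists i; rewrite inE yi oner_neq0.
have [d [Ld sd [_ d0 _] /conformal_supp /subsetP cd]] := UL.2 y Ly s0.
have dy e : y e = 0 -> d e = 0.
  by move=> ye; apply/eqP/negPn/negP=> de; have := cd e; rewrite !inE de ye eqxx => /(_ isT).
(* [z] vanishes at [i], at [r 0], ..., [r (n-1)] and at every non-basis element off the chain. Row
   expansion at [r q] then kills the entries at [j q] one after another, so [d] is the multiple
   [d i] of [y], which has an entry 2 or -2 at [r n]. *)
pose z e := d e + (- d i) * y e.
have Lz : L z by apply: lin_closedD UL.1 Ld Ly.
have zi : z i = 0 by rewrite /z yi mulr1 subrr.
have zr m : (m < n)%N -> z (r m) = 0.
  by move=> mn; rewrite /z dy ysum // mulr0 addr0.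
have zk k : k \notin T -> k != i -> (forall q, (q < n)%N -> k != j q) -> z k = 0.
  move=> kT ki kj; have yk : y k = 0.
    rewrite /y mul1r fund_off // eq_sym (negPf ki) add0r big1 // => q _.
    have [jqT jqi] := jT q (ltn_ord q).
    by rewrite fund_off // eq_sym (negPf (kj q _)) ?mulr0.
  by rewrite /z dy // yk mulr0 addr0.
have jinj p q : (p < n)%N -> (q < n)%N -> j p = j q -> p = q.
  move=> pn qn e.
  have h1 : (p == q) || (p == q.+1).
    by rewrite -jr // ?(ltnW pn) // -e jr // ?(ltnW pn) // eqxx.
  have h2 : (p.+1 == q) || (p.+1 == q.+1) by rewrite -jr // -e jr // eqxx orbT.
  lia.
have zj q : (q < n)%N -> z (j q) = 0.
  elim/ltn_ind: q => q IH qn; have [jqT jqi] := jT q qn.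
  have := fund_expand (r q) Lz; rewrite zr // (bigD1 (j q)) //= big1.
    rewrite addr0 => /esym/eqP; rewrite mulf_eq0 => /orP [/eqP //|].
    by rewrite -[_ == 0]negbK jr ?(ltnW qn) // eqxx.
  move=> k /andP [kT kq]; have [->|ki] := eqVneq k i; first by rewrite zi mul0r.
  have [[p pk]|nk] := pickP (fun p : 'I_n => k == j p).
    move=> /= /eqP kp; rewrite kp; have [pq|qp] := ltnP p q.
      by rewrite IH ?mul0r.
    apply/eqP; rewrite mulf_eq0; apply/orP; right; apply/negPn.
    rewrite jr ?(ltnW qn) // negb_or; apply/andP; split.
      by apply: contraNneq kq => ->; rewrite kp.
    by rewrite (ltn_eqF (leq_ltn_trans qp (ltnSn p))).
  by rewrite zk ?mul0r // => p pn; have := nk (Ordinal pn) => /= ->.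
have z0 e : z e = 0.
  rewrite (fund_expand e Lz) big1 // => k kT.
  have [->|ki] := eqVneq k i; first by rewrite zi mul0r.
  have [p /eqP ->|nk] := pickP (fun p : 'I_n => k == j p); first by rewrite zj ?mul0r.
  by rewrite zk ?mul0r // => p pn; have := nk (Ordinal pn) => /= ->.
have dE e : d e = d i * y e by have := z0 e; rewrite /z mulNr => /subr0_eq.
have di : sign1 (d i).
  apply: signvec_neq0 => //; move/set0Pn: d0 => [e]; rewrite inE dE.
  by apply: contraNneq => ->; rewrite mul0r.
have sn : sign1 (g i (r n)) by apply: si; rewrite ?eqxx ?orbT.
have := sd (r n); have := ynz; rewrite dE yn => h1 h2.
have := sa n (leqnn n); move: h1 h2; case: sn => ->; case: di => -> h1 h2 [] h3;
  move: h1 h2; rewrite h3 => /eqP h1 [|[]] h2; lra.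
Qed.
End Basis.

(** * A unimodular space is determined by its circuits up to signs *)

Section Signing.
Variables (F : realFieldType) (E : finType).
Implicit Types (L : (E -> F) -> Prop) (eps : E -> F) (S T : {set E}) (g : E -> E -> F).

Definition twist eps L : (E -> F) -> Prop := fun x => L (fun e => eps e * x e).

Lemma twistK eps L : (forall e, sign1 (eps e)) -> twist eps (twist eps L) = L.
Proof.
move=> se; apply/funext=> x; rewrite /twist; congr L; apply/funext=> e.
by rewrite mulrA sign1_sqr ?mul1r.
Qed.

Lemma supp_twist eps x : (forall e, sign1 (eps e)) -> supp (fun e => eps e * x e) = supp x.
Proof.
by move=> se; apply/setP=> e; rewrite !inE mulf_eq0 negb_or (sign1_neq0 (se e)).
Qed.

Lemma twist_circuitW eps L S :
  (forall e, sign1 (eps e)) -> circuit L S -> circuit (twist eps L) S.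
Proof.
move=> se [[x Lx xS] S0 Smin]; split=> //.
  by exists (fun e => eps e * x e); [rewrite -/(twist eps _ x) -/(twist eps (twist eps L) x) twistK
                                   | rewrite supp_twist].
by move=> y Ly; rewrite -(supp_twist y se); apply: Smin.
Qed.

Lemma twist_circuit eps L S :
  (forall e, sign1 (eps e)) -> circuit (twist eps L) S <-> circuit L S.
Proof.
move=> se; split; last exact: twist_circuitW.
by move=> /(twist_circuitW se); rewrite twistK.
Qed.

Lemma twist_unimodular eps L :
  (forall e, sign1 (eps e)) -> unimodular L -> unimodular (twist eps L).
Proof.
move=> se [[L0 LD] U]; split.
  split=> [|x y c]; rewrite /twist.
    by move: L0; congr L; apply/funext=> e; rewrite mulr0.
  move=> Lx Ly; have := LD _ _ c Lx Ly; congr L; apply/funext=> e; ring.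
move=> x Lx x0; have [|d [Ld sd Cd cd]] := U _ Lx; first by rewrite supp_twist.
exists (fun e => eps e * d e); split.
- by rewrite -/(twist eps (twist eps L) d) twistK.
- move=> e; have [->|s] := sd e; first by left; rewrite mulr0.
  by right; apply: sign1M.
- by rewrite supp_twist //; apply/twist_circuit.
- move=> e; rewrite mulf_eq0 negb_or => /andP [_ /cd].
  by rewrite mulrCA mulrA.
Qed.

(** A maximal circuit-free set is defined by the circuits alone, so it serves both spaces. Adding
    [i] creates a circuit through [i], whose two signed vectors are scaled to have entry 1 at
    [i]. *)
Lemma exists_basis L L' : unimodular L -> unimodular L' ->
  (forall S, circuit L S <-> circuit L' S) ->
  exists T g g', [/\ forall S, S \subset T -> ~ circuit L S,
    fundamental L T g, fundamental L' T g' &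
    forall i, i \notin T -> supp (g i) = supp (g' i)].
Proof.
move=> UL UL' LL'.
pose P T := [forall S : {set E}, (S \subset T) ==> ~~ pbool (circuit L S)].
have P0 : P set0.
  apply/forallP=> S; apply/implyP; rewrite subset0 => /eqP ->; apply/pboolP=> -[_].
  by rewrite eqxx.
have [T /maxsetP [PT Tmax] _] := maxset_exists P0.
have Tfree S : S \subset T -> ~ circuit L S.
  by move=> ST /pboolP; apply/negP; move/forallP: PT => /(_ S); rewrite ST.
have ex i : exists u : (E -> F) * (E -> F), i \notin T ->
    [/\ [/\ L u.1, signvec u.1, u.1 i = 1 & supp u.1 \subset i |: T],
        [/\ L' u.2, signvec u.2, u.2 i = 1 & supp u.2 \subset i |: T] &
        supp u.1 = supp u.2].
  have [iT|iT] := boolP (i \in T); first by exists (fun=> 0, fun=> 0).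
  have : ~~ P (i |: T).
    apply/negP=> PiT; have := Tmax _ PiT (subsetUr _ _) => /setP /(_ i).
    by rewrite !inE eqxx (negPf iT).
  rewrite negb_forall => /existsP [S]; rewrite negb_imply negbK => /andP [SiT /pboolP CS].
  have iS : i \in S.
    apply/negPn/negP=> iS; apply: (Tfree S) CS; apply/subsetP=> e eS.
    by have := subsetP SiT e eS; rewrite !inE => /orP [/eqP ei|//]; rewrite -ei eS in iS.
  have norm (M : (E -> F) -> Prop) : unimodular M -> circuit M S ->
      exists d, [/\ M d, signvec d, d i = 1 & supp d = S].
    move=> UM CM; have [d [Md sd dS]] := circuit_vec UM CM.
    have di : d i != 0 by move: iS; rewrite -dS inE.
    have [d1|d1] := signvec_neq0 sd di; first by exists d.
    exists (fun e => (-1) * d e); split.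
    - exact: lin_closedZ UM.1 Md.
    - move=> e; rewrite mulN1r; have [->|s] := sd e; first by left; rewrite oppr0.
      by right; apply: sign1N.
    - by rewrite d1 mulrNN mulr1.
    - by rewrite -dS; apply/setP=> e; rewrite !inE mulN1r oppr_eq0.
  have [d [Ld sd di dS]] := norm L UL CS.
  have [d' [Ld' sd' di' dS']] := norm L' UL' ((LL' S).1 CS).
  by exists (d, d') => _; rewrite /= dS dS'.
have [u uP] := boolp.choice ex.
exists T, (fun i => (u i).1), (fun i => (u i).2); split=> //.
- by move=> i iT; have [] := uP i iT.
- by move=> i iT; have [] := uP i iT.
- by move=> i iT; have [] := uP i iT.
Qed.

(** Columns at distance two in the bipartite graph of nonzero entries, restricted to the rows in [s]
    already treated. *)
Definition linked g (s : seq E) : rel E :=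
  fun a b => has (fun j => (g j a != 0) && (g j b != 0)) s.

Lemma linked_sym g s : symmetric (linked g s).
Proof. by move=> a b; apply: eq_has => j; rewrite andbC. Qed.

(** Induction on the length of the path: an interior column met by row [i] splits it, and a link
    between non-consecutive columns shortens it. What remains is a chordless chain, where both
    spaces obey the same sign rule, their rows in [s] being equal. *)
Lemma ratio_path L1 L2 T g1 g2 (s : seq E) i :
  unimodular L1 -> unimodular L2 ->
  (forall S, S \subset T -> ~ circuit L1 S) -> (forall S, S \subset T -> ~ circuit L2 S) ->
  fundamental L1 T g1 -> fundamental L2 T g2 ->
  (forall j, j \in s -> j \notin T /\ g2 j = g1 j) -> i \notin T -> i \notin s ->
  supp (g1 i) = supp (g2 i) ->
  forall p t, path (linked g1 s) t p -> g1 i t != 0 -> g1 i (last t p) != 0 ->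
    g1 i t * g2 i t = g1 i (last t p) * g2 i (last t p).
Proof.
move=> U1 U2 F1 F2 G1 G2 sT iT is_ supp12 p.
move: {2}(size p) (leqnn (size p)) => N; elim: N p => [|N IH] p.
  by rewrite leqn0 size_eq0 => /eqP ->.
move=> pN t tp t0 tl.
pose n := size p; pose r m := nth t (t :: p) m.
have lastE : last t p = r n by exact: last_nth.
have n_gt0 : (0 < n)%N \/ n = 0%N by case: (n); [right|left].
case: n_gt0 => n0; last first.
  by have -> : p = [::] by apply: size0nil.
have rlink q : (q < n)%N -> linked g1 s (r q) (r q.+1).
  by move=> qn; have /pathP := tp => /(_ t q qn).
have sub q : (q <= n)%N -> path (linked g1 s) t (take q p) /\ last t (take q p) = r q.
  move=> qn; split; first by move: tp; rewrite -{1}(cat_take_drop q p) cat_path => /andP [].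
  rewrite /r; case: q qn => [|q] qn; first by rewrite take0.
  by rewrite (last_nth t) size_takel //= nth_take.
have sub' q : (q <= n)%N -> path (linked g1 s) (r q) (drop q p) /\ last (r q) (drop q p) = r n.
  move=> qn; have [_ lq] := sub q qn; rewrite -lq; split.
    by move: tp; rewrite -{1}(cat_take_drop q p) cat_path => /andP [].
  by rewrite -last_cat cat_take_drop.
have [m /andP [/andP [m0 mn] mi]|noint] :=
    pickP (fun m : 'I_n.+1 => (0 < m)%N && (m < n)%N && (g1 i (r m) != 0)).
  have [p1 l1] := sub _ (ltnW mn); have [p2 l2] := sub' _ (ltnW mn).
  have -> : g1 i t * g2 i t = g1 i (r m) * g2 i (r m).
    rewrite -l1; apply: IH; rewrite ?l1 //.
    by rewrite size_takel ?(ltnW mn) // -ltnS; apply: leq_trans pN.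
  rewrite lastE -l2; apply: IH => //; last by rewrite l2 -lastE.
  by rewrite size_drop; move: pN; rewrite -/n; lia.
have [[a b] /= /andP [ab lab]|nosc] :=
    pickP (fun u : 'I_n.+1 * 'I_n.+1 => (u.1.+1 < u.2)%N && linked g1 s (r u.1) (r u.2)).
  have an : (a <= n)%N by rewrite -ltnS.
  have bn : (b <= n)%N by rewrite -ltnS.
  have [p1 l1] := sub a an; have [p2 l2] := sub' b bn.
  have lE : last t (take a p ++ r b :: drop b p) = last t p.
    by rewrite last_cat /= l2 lastE.
  rewrite -lE; apply: IH => //; last by rewrite lE.
    by rewrite size_cat /= size_takel // size_drop -/n; move: pN; rewrite -/n; lia.
  by rewrite cat_path p1 /= l1 lab.
have ex q : exists j, (q < n)%N -> [&& j \in s, g1 j (r q) != 0 & g1 j (r q.+1) != 0].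
  have [qn|] := boolP (q < n)%N; last by exists t.
  by have /hasP [j js /andP [h1 h2]] := rlink q qn; exists j; rewrite js h1 h2.
have [j jP] := boolp.choice ex.
have jr q m : (q < n)%N -> (m <= n)%N -> (g1 (j q) (r m) != 0) = (m == q) || (m == q.+1).
  move=> qn mn; have /and3P [js h1 h2] := jP q qn.
  apply/idP/idP=> [h|/orP [] /eqP -> //].
  have mn' : (m < n.+1)%N by []; have qn' : (q < n.+1)%N by apply: ltnW.
  have qn2 : (q.+1 < n.+1)%N by [].
  have [mq|qm|->] := ltngtP m q; last by [].
    have := nosc (Ordinal mn', Ordinal qn2); rewrite /= ltnS mq /=.
    by move=> /negbT /hasPn /(_ _ js); rewrite h h2.
  have [mq|mq|//] := ltngtP m q.+1; first by move: mq; rewrite ltnS leqNgt qm.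
  have := nosc (Ordinal qn', Ordinal mn'); rewrite /= mq /= => /negbT /hasPn /(_ _ js).
  by rewrite h h1.
have ir m : (m <= n)%N -> (g1 i (r m) != 0) = (m == 0%N) || (m == n).
  move=> mn; apply/idP/idP=> [h|/orP [] /eqP -> //]; last by rewrite -lastE.
  have mn' : (m < n.+1)%N by [].
  have := noint (Ordinal mn'); rewrite /= h andbT; lia.
have jT q : (q < n)%N -> j q \notin T /\ j q != i.
  move=> qn; have /and3P [js _ _] := jP q qn; split; first by have [] := sT _ js.
  by apply: contraNneq is_ => <-.
have gj q : (q < n)%N -> g2 (j q) = g1 (j q).
  by move=> qn; have /and3P [js _ _] := jP q qn; have [] := sT _ js.
have i12 e : (g2 i e != 0) = (g1 i e != 0) by have /setP /(_ e) := supp12; rewrite !inE.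
have c1 := chordless_chain U1 F1 G1 iT n0 jT jr ir.
have c2 : g2 i (r n) = - (g2 i (r 0%N) * \prod_(q < n) - (g1 (j q) (r q.+1) * g1 (j q) (r q))).
  rewrite (chordless_chain U2 F2 G2 iT n0 jT).
  - by congr (- (_ * _)); apply: eq_bigr => q _; rewrite gj.
  - by move=> q m qn mn; rewrite gj // jr.
  - by move=> m mn; rewrite i12 ir.
set K := \prod_(q < n) _ in c1 c2.
have sK : sign1 K.
  apply: (big_ind (@sign1 F)); [by left | by move=> x y; apply: sign1M |].
  move=> q _; have qn := ltn_ord q; have [jqT _] := jT q qn; have [_ sg _ _] := G1 _ jqT.
  have /and3P [_ h1 h2] := jP q qn.
  by apply/sign1N/sign1M; apply: signvec_neq0.
by rewrite lastE c1 c2 mulrNN mulrACA (sign1_sqr sK) mulr1.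
Qed.

(** Signs are adjusted one row at a time. Once [L'] is twisted so that the old rows agree, the ratio
    of the two versions of the new row is constant on each component of linked columns, and flipping
    whole components corrects it. The row factor can be taken to be [eps j] because both versions of
    row [j] have entry 1 at [j]. *)
Theorem unimodular_signing L L' : unimodular L -> unimodular L' ->
  (forall S, circuit L S <-> circuit L' S) ->
  exists2 eps, forall e, sign1 (eps e) & forall x, L x <-> L' (fun e => eps e * x e).
Proof.
move=> UL UL' LL'; have [T [g [g' [Tfree G G' gg']]]] := exists_basis UL UL' LL'.
have Tfree' S : S \subset T -> ~ circuit L' S by move=> ST /LL'; apply: Tfree.
have step (s : seq E) : (forall j, j \in s -> j \notin T) ->
    exists2 eps, forall e, sign1 (eps e) &
      forall j, j \in s -> forall e, g' j e = eps j * eps e * g j e.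
  elim: s => [|i s IH] sT; first by exists (fun=> 1) => // e; left.
  have iT : i \notin T by apply: sT; rewrite inE eqxx.
  have [j js|eps se epsP] := IH; first by apply: sT; rewrite inE js orbT.
  have [is_|is_] := boolP (i \in s).
    by exists eps => // j; rewrite inE => /orP [/eqP ->|]; apply: epsP.
  pose L2 := twist eps L'; pose g2 j e := eps j * (eps e * g' j e).
  have U2 : unimodular L2 by apply: twist_unimodular.
  have F2 S : S \subset T -> ~ circuit L2 S by move=> ST /(twist_circuit _ _ se); apply: Tfree'.
  have supp2 j : supp (g2 j) = supp (g' j).
    by apply/setP=> e; rewrite !inE !mulf_eq0 !negb_or !(sign1_neq0 (se _)).
  have G2 : fundamental L2 T g2.
    move=> j jT; have [Lg sg g1 sub] := G' j jT; split.
    - rewrite /L2 /twist /g2; have := lin_closedZ (eps j) UL'.1 Lg.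
      by congr L'; apply/funext=> e; rewrite mulrCA; congr (_ * _); rewrite mulrA sign1_sqr ?mul1r.
    - move=> e; rewrite /g2; have [->|h] := sg e; first by left; rewrite !mulr0.
      by right; do 2?apply: sign1M.
    - by rewrite /g2 g1 mulr1 sign1_sqr.
    - by rewrite supp2.
  have g2s j : j \in s -> j \notin T /\ g2 j = g j.
    move=> js; split; first by apply: sT; rewrite inE js orbT.
    apply/funext=> e; rewrite /g2 epsP //.
    transitivity ((eps j * eps j) * (eps e * eps e) * g j e); first by ring.
    by rewrite (sign1_sqr (se j)) (sign1_sqr (se e)) !mul1r.
  have rp := ratio_path UL U2 Tfree F2 G G2 g2s iT is_.
  pose rho t := g i t * g2 i t.
  have rhoC t t' : connect (linked g s) t t' -> g i t != 0 -> g i t' != 0 -> rho t = rho t'.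
    by move=> /connectP [p pp ->] h1 h2; apply: rp => //; rewrite supp2 gg'.
  have csym : connect_sym (linked g s) by apply: sym_connect_sym; apply: linked_sym.
  (* The common ratio of the component of [e]; components that row [i] misses keep their signs. *)
  pose w e := if [pick t | connect (linked g s) e t && (g i t != 0)] is Some t then rho t else 1.
  have srho t : g i t != 0 -> sign1 (rho t).
    move=> gt; have [_ s1 _ _] := G _ iT; have [_ s2 _ _] := G2 _ iT.
    have g2t : g2 i t != 0.
      by have /setP /(_ t) := gg' _ iT; rewrite -supp2 !inE gt => <-.
    by apply: sign1M; apply: signvec_neq0.
  have sw e : sign1 (w e).
    by rewrite /w; case: pickP => [t /andP [_ /srho]|_] //; left.
  have wi t : g i t != 0 -> w t = rho t.
    move=> gt; rewrite /w; case: pickP => [t' /andP [h1 h2]|/(_ t)]; last by rewrite connect0 gt.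
    by apply/esym/rhoC.
  have wC a b : connect (linked g s) a b -> w a = w b.
    move=> ab; rewrite /w; congr (if _ is Some t then rho t else 1).
    by apply: eq_pick => t; rewrite (same_connect csym ab).
  exists (fun e => eps e * w e) => [e|j]; first exact: sign1M.
  rewrite inE => /orP [/eqP -> | js] e.
    have gi1 : g i i = 1 by have [] := G _ iT.
    have gi2 : g2 i i = 1 by have [] := G2 _ iT.
    have [ge|ge] := eqVneq (g i e) 0.
      have : g' i e = 0 by apply/eqP; have /setP /(_ e) := gg' _ iT; rewrite !inE ge eqxx => /esym/negbFE.
      by move=> ->; rewrite ge mulr0.
    rewrite (wi e ge) (wi i) ?gi1 ?oner_neq0 // /rho gi1 gi2 mulr1 mulr1.
    have sgi : g i e * g i e = 1 by apply: sign1_sqr; apply: signvec_neq0 => //; have [] := G _ iT.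
    have := sign1_sqr (se i); have := sign1_sqr (se e); rewrite /g2 => h1 h2.
    transitivity ((eps i * eps i) * (eps e * eps e) * (g i e * g i e) * g' i e); last by ring.
    by rewrite h1 h2 sgi !mul1r.
  (* The support of an old row lies in one component, where [w] is constant, so its two occurrences
     multiply to 1. *)
  rewrite epsP //; have [->|ge] := eqVneq (g j e) 0; first by rewrite !mulr0.
  have gj1 : g j j = 1 by have [] := G j (sT j _); rewrite // inE js orbT.
  have je : connect (linked g s) j e.
    by apply: connect1; apply/hasP; exists j => //; rewrite gj1 oner_neq0 ge.
  by rewrite (wC _ _ je) mulrACA (sign1_sqr (sw e)) mulr1.
have [j|eps se epsP] := step (enum (~: T)); first by rewrite mem_enum inE.
have {}epsP j e : j \notin T -> g' j e = eps j * eps e * g j e.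
  by move=> jT; apply: epsP; rewrite mem_enum inE.
exists eps => // x; split=> Lx.
  have := lin_closed_sum (index_enum E) (fun j => eps j * x j) UL'.1 (P := fun j => j \notin T) (g := g').
  have Lg' i : i \notin T -> L' (g' i) by move=> iT; have [] := G' i iT.
  move=> /(_ Lg'); congr L'; apply/funext=> e; rewrite (fund_expand UL Tfree G e Lx) mulr_sumr.
  apply: eq_bigr => j jT; rewrite epsP //.
  have := sign1_sqr (se j) => h; transitivity ((eps j * eps j) * (eps e * (x j * g j e))); first by ring.
  by rewrite h mul1r.
have := lin_closed_sum (index_enum E) x UL.1 (P := fun j => j \notin T) (g := g).
have Lg i : i \notin T -> L (g i) by move=> iT; have [] := G i iT.
move=> /(_ Lg); congr L; apply/funext=> e.
have := fund_expand UL' Tfree' G' e Lx => /(congr1 (fun a => eps e * a)).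
rewrite mulrA sign1_sqr // mul1r => ->; rewrite mulr_sumr; apply: eq_bigr => j jT.
rewrite epsP //; transitivity ((eps j * eps j) * (eps e * eps e) * (x j * g j e)); last by ring.
by rewrite (sign1_sqr (se j)) (sign1_sqr (se e)) !mul1r.
Qed.

End Signing.

(** * Flows on a graph *)

Section Flow.
Variable C : tgraph.
Implicit Types (x y z d : tE C -> R) (p : tV C -> R).

Definition bd x v : R := \sum_(e | ttgt C e == v) x e - \sum_(e | tsrc C e == v) x e.
Definition flow x : Prop := forall v, bd x v = 0.

(** Duality of boundary and coboundary. Testing against all potentials avoids case analysis at
    vertices: flows pair to 0, and the chain of a walk pairs to the difference of [p] at its
    ends. *)
Definition pairing x p : R := \sum_e x e * (p (ttgt C e) - p (tsrc C e)).

Lemma inH1E (x : jvec C) : inH1 x <-> flow (fun e => x (inl e)).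
Proof. exact: iff_refl. Qed.

Lemma sum_delta (T : finType) (f : T -> R) (u : T) : \sum_v f v * (u == v)%:R = f u.
Proof.
rewrite (bigD1 u) //= eqxx mulr1 big1 ?addr0 // => v vu.
by rewrite eq_sym (negPf vu) mulr0.
Qed.

Lemma bdE x v : bd x v = pairing x (fun u => (v == u)%:R).
Proof.
rewrite /bd /pairing; under [RHS]eq_bigr do rewrite mulrBr.
by rewrite sumrB; congr (_ - _); rewrite big_mkcond; apply: eq_bigr => e _;
  rewrite eq_sym; case: eqP; rewrite ?mulr1 ?mulr0.
Qed.

Lemma sum_bd x p : \sum_v p v * bd x v = pairing x p.
Proof.
under eq_bigr => v _ do rewrite bdE /pairing mulr_sumr.
rewrite exchange_big /=; apply: eq_bigr => e _.
rewrite -[p (ttgt C e)](sum_delta p) -[p (tsrc C e)](sum_delta p) -sumrB mulr_sumr.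
by apply: eq_bigr => v _; rewrite !(eq_sym v); ring.
Qed.

Lemma flowP x : flow x <-> forall p, pairing x p = 0.
Proof.
split=> [fx p|h v]; last by rewrite bdE.
by rewrite -sum_bd big1 // => v _; rewrite fx mulr0.
Qed.

Lemma pairingD x y c p : pairing (fun e => x e + c * y e) p = pairing x p + c * pairing y p.
Proof. by rewrite /pairing mulr_sumr -big_split; apply: eq_bigr => e _ /=; ring. Qed.

Lemma flow_lin : lin_closed flow.
Proof.
split=> [|x y c /flowP fx /flowP fy]; apply/flowP=> p.
  by rewrite /pairing big1 // => e _; rewrite mul0r.
by rewrite pairingD fx fy mulr0 addr0.
Qed.

Lemma pairing_delta (e : tE C) p :
  pairing (fun f => (e == f)%:R) p = p (ttgt C e) - p (tsrc C e).
Proof. by rewrite -[RHS](sum_delta (fun f => p (ttgt C f) - p (tsrc C f))); apply: eq_bigr => f _; rewrite mulrC. Qed.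

Lemma joins_sign e a b : joins e a b ->
  exists2 s : R, sign1 s & forall p, s * (p (ttgt C e) - p (tsrc C e)) = p b - p a.
Proof.
case/orP=> /andP [/eqP <- /eqP <-]; [exists 1; first by left|exists (-1); first by right] => p.
  by rewrite mul1r.
by rewrite mulN1r opprB.
Qed.

(** The signed sum of the edges of a walk, given by its boundary and a bound on its support; the
    walk may repeat edges, so the entries themselves are not controlled. *)
Lemma path_flow (P : pred (tE C)) (Vok : pred (tV C)) a b :
  connect (adj_in P Vok) a b ->
  exists2 z, forall e, z e != 0 -> [/\ P e, Vok (tsrc C e) & Vok (ttgt C e)] &
             forall p, pairing z p = p b - p a.
Proof.
case/connectP=> s; elim: s a => [|c s IH] a /=.
  move=> _ ->; exists (fun=> 0) => [e|p]; first by rewrite eqxx.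
  by rewrite subrr /pairing big1 // => e _; rewrite mul0r.
case/andP=> /and3P [oka okc /existsP [e /andP [Pe je]]] sp bE.
have [z zs zp] := IH c sp bE; have [t _ tp] := joins_sign je.
exists (fun f => z f + t * (e == f)%:R) => [f|p]; last by rewrite pairingD zp pairing_delta tp; ring.
have [<- _|ef] := eqVneq e f; last by rewrite mulr0 addr0 => /zs.
by case/orP: je => /andP [/eqP -> /eqP ->].
Qed.

Lemma pot_const (P : pred (tE C)) (Vok : pred (tV C)) (T : eqType) (p : tV C -> T) a b :
  (forall e, P e -> Vok (tsrc C e) -> Vok (ttgt C e) -> p (ttgt C e) = p (tsrc C e)) ->
  connect (adj_in P Vok) a b -> p a = p b.
Proof.
move=> pe /connectP [s]; elim: s a => [|c s IH] a /=; first by move=> _ ->.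
case/andP=> /and3P [oka okc /existsP [e /andP [Pe je]]] sp bE.
rewrite -(IH c sp bE); have := pe e Pe.
by case/orP: je => /andP [/eqP -> /eqP ->] -> //.
Qed.

Section Direct.
Variable x : tE C -> R.
Hypothesis fx : flow x.

(** Edges are reoriented along [x]: head, tail, sign of the change, and the set [W] of vertices
    emitting flow. Within this section [tl] is the tail and shadows the length. *)
Let hd e := if 0 < x e then ttgt C e else tsrc C e.
Let tl e := if 0 < x e then tsrc C e else ttgt C e.
Let sg e : R := if 0 < x e then 1 else -1.
Let W v := [exists e, (x e != 0) && (tl e == v)].

Lemma sg_pot e p : sg e * (p (ttgt C e) - p (tsrc C e)) = p (hd e) - p (tl e).
Proof. by rewrite /sg /hd /tl; case: ifP => _; rewrite ?mul1r // mulN1r opprB. Qed.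

Lemma sg_norm e : x e = `|x e| * sg e.
Proof.
rewrite /sg; case: ifP => [h|/negbT]; first by rewrite gtr0_norm // mulr1.
by rewrite -leNgt => h; rewrite ler0_norm // mulrN1 opprK.
Qed.

(** A vertex that received flow and emitted none would pair positively with its indicator. *)
Lemma head_tail e : x e != 0 -> W (hd e).
Proof.
move=> xe; have [//|] := boolP (W (hd e)); rewrite /W negb_exists => /forallP nW; exfalso.
have /flowP /(_ (fun u => (hd e == u)%:R)) := fx; apply/eqP; rewrite gt_eqF //.
rewrite /pairing (bigD1 e) //= [x e]sg_norm -mulrA (sg_pot e (fun u => (hd e == u)%:R)) eqxx.
have tle f : x f != 0 -> (hd e == tl f) = false.
  by move=> xf; have := nW f; rewrite xf /= eq_sym => /negbTE.
rewrite tle // subr0 mulr1 ltr_pwDl ?normr_gt0 // sumr_ge0 // => f _.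
rewrite [x f]sg_norm -mulrA (sg_pot f (fun u => (hd e == u)%:R)); have [->|xf] := eqVneq (x f) 0; first by rewrite normr0 mul0r.
by rewrite tle // subr0 mulr_ge0 // ler0n.
Qed.

(** Following the flow forward must revisit a vertex, and the first repetition cuts out a simple
    circuit. It is conformal because it is traversed in the direction of [x]. *)
Lemma direct_cycle : supp x != set0 ->
  exists d, [/\ flow d, signvec d, is_cycle (supp d) & conformal d x].
Proof.
case/set0Pn=> e0; rewrite inE => e00.
pose out v := odflt e0 [pick e | (x e != 0) && (tl e == v)].
have outP v : W v -> x (out v) != 0 /\ tl (out v) = v.
  case/existsP=> e h; rewrite /out; case: pickP => [f /andP [h1 /eqP h2]|/(_ e)] //.
  by rewrite h.
pose nx v := hd (out v).
have nxW v : W v -> W (nx v) by move=> /outP [h _]; apply: head_tail.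
pose v0 := tl e0; have W0 : W v0 by apply/existsP; exists e0; rewrite e00 eqxx.
have iW n : W (iter n nx v0) by elim: n => //= n; apply: nxW.
(* The orbit of [v0] has [n] distinct points and returns to its [i]-th one; the circuit is the
   periodic part, of length [n - i]. *)
have /trajectP [i ilt iE] := looping_order nx v0; set n := order nx v0 in ilt iE.
pose y := iter i nx v0; pose k := (n - i)%N; pose vs := traject nx y k.
have k0 : (0 < k)%N by rewrite subn_gt0.
have yk : iter k nx y = y by rewrite /y -iterD subnK ?(ltnW ilt) // -iE.
have uvs : uniq vs.
  have : uniq (traject nx v0 n) := orbit_uniq nx v0.
  by rewrite -(subnKC (ltnW ilt)) trajectD cat_uniq => /and3P [_ _].
have vsW v : v \in vs -> W v by case/trajectP=> m _ ->; rewrite /y -iterD.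
have rvs : rot 1 vs = map nx vs.
  rewrite /vs; case: (k) k0 yk => // k' _ yk.
  have mt m u : map nx (traject nx u m) = traject nx (nx u) m by elim: m u => //= m IH u; rewrite IH.
  by rewrite mt trajectS rot1_cons trajectSr -iterSr yk.
pose es := map out vs.
have ues : uniq es.
  rewrite map_inj_in_uniq // => u v uin vin /(congr1 tl).
  by have [_ ->] := outP _ (vsW _ uin); have [_ ->] := outP _ (vsW _ vin).
pose d e := if e \in es then sg e else 0.
have sE : supp d = [set e in es].
  apply/setP=> e; rewrite !inE /d; case: ifP; rewrite ?eqxx // /sg.
  by case: ifP; rewrite ?oppr_eq0 oner_neq0.
have xes e : e \in es -> x e != 0 by case/mapP=> v /vsW /outP [h _] ->.
exists d; split.
- apply/flowP=> p; rewrite /pairing.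
  have -> : \sum_e d e * (p (ttgt C e) - p (tsrc C e)) = \sum_(e in es) (p (hd e) - p (tl e)).
    rewrite [RHS]big_mkcond; apply: eq_bigr => e _; rewrite /d; case: ifP; rewrite ?mul0r //.
    by rewrite sg_pot.
  rewrite -big_uniq //= /es big_map.
  have -> : \sum_(v <- vs) (p (hd (out v)) - p (tl (out v))) = \sum_(v <- vs) (p (nx v) - p v).
    rewrite big_seq_cond [RHS]big_seq_cond; apply: eq_bigr => v /andP [/vsW /outP [_ ->]] //.
  rewrite sumrB -(big_map nx predT p) -rvs.
  by rewrite (perm_big vs) ?perm_rot //= subrr.
- move=> e; rewrite /d; case: ifP => _; last by left.
  by right; rewrite /sg; case: ifP; [left|right].
- rewrite sE; exists vs, es; split=> //; first by rewrite size_map size_traject.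
  rewrite rvs => q; have -> : zip es (zip vs (map nx vs)) = map (fun v => (out v, (v, nx v))) vs.
    by rewrite /es; elim: (vs) => //= v s ->.
  case/mapP=> v /vsW /outP [_ tv] -> /=; rewrite /joins.
  by move: tv; rewrite /nx /tl /hd; case: ifP => _ ->; rewrite !eqxx ?orbT.
- move=> e; rewrite /d; case: ifP; last by rewrite eqxx.
  move=> /xes xe _; rewrite [x e]sg_norm mulrCA pmulr_rgt0 ?normr_gt0 //.
  by rewrite /sg; case: ifP => _; rewrite ?mulrNN mulr1 ltr01.
Qed.
End Direct.

(** Inside [S], a vertex of the circuit meets only its two consecutive edges, so conservation makes
    the value measured along the traversal constant. The resulting uniqueness up to a scalar gives
    minimality of the support. *)
Lemma cycle_vec S : is_cycle S -> exists d,
  [/\ flow d, signvec d, supp d = S, S != set0 &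
      forall y, flow y -> supp y \subset S -> exists c, forall e, y e = c * d e].
Proof.
case=> vs [es [[k0 svs] uvs ues SE js]].
have [e0 e0s] : exists e0, e0 \in es by case: (es) k0 => // e s _; exists e; rewrite inE eqxx.
pose v0 := tsrc C e0; pose k := size es.
pose ee i := nth e0 es i; pose a i := nth v0 vs i; pose b i := nth v0 (rot 1 vs) i.
have bS m : (m < k)%N -> b m = if (m.+1 < k)%N then a m.+1 else a 0%N.
  rewrite /b /a /k -svs; case: (vs) => [|v vs'] //=; rewrite rot1_cons nth_rcons !ltnS.
  by case: ltngtP.
have jj i : (i < k)%N -> joins (ee i) (a i) (b i).
  move=> ik; have sz : size vs = size (rot 1 vs) by rewrite size_rot.
  have sz2 : size es = size (zip vs (rot 1 vs)) by rewrite size_zip -sz minnn.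
  have := js (nth (e0, (v0, v0)) (zip es (zip vs (rot 1 vs))) i).
  rewrite nth_zip // nth_zip //=; apply.
  by rewrite -nth_zip // -nth_zip // mem_nth // size_zip -sz2 minnn.
have ex i : exists t : R, (i < k)%N -> sign1 t /\
    forall p, t * (p (ttgt C (ee i)) - p (tsrc C (ee i))) = p (b i) - p (a i).
  have [ik|] := boolP (i < k)%N; last by exists 0.
  by have [t st tp] := joins_sign (jj i ik); exists t.
have [s sP] := boolp.choice ex.
pose d e := if e \in es then s (index e es) else 0.
have dee i : (i < k)%N -> d (ee i) = s i.
  by move=> ik; rewrite /d mem_nth // index_uniq.
have sE : supp d = S.
  rewrite SE; apply/setP=> e; rewrite !inE /d; case: ifP; rewrite ?eqxx // => h.
  by rewrite sign1_neq0 //; have [] := sP (index e es) _; rewrite // index_mem.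
have pe y p : supp y \subset S ->
    pairing y p = \sum_(i < k) (y (ee i) * s i) * (p (b i) - p (a i)).
  move=> yS; rewrite /pairing.
  transitivity (\sum_(e in es) y e * (p (ttgt C e) - p (tsrc C e))).
    rewrite [RHS]big_mkcond; apply: eq_bigr => e _; case: ifP => // h.
    suff -> : y e = 0 by rewrite mul0r.
    by apply/eqP/negPn/negP=> ye; have := subsetP yS e; rewrite SE !inE h => /(_ ye).
  rewrite -big_uniq //= (big_nth e0) big_mkord; apply: eq_bigr => i _.
  have [si <-] := sP i (ltn_ord i); rewrite -/(ee i).
  by rewrite -mulrA [s i * (s i * _)]mulrA sign1_sqr // mul1r.
exists d; split=> //.
- apply/flowP=> p; rewrite pe ?sE //.
  transitivity (\sum_(i < k) (p (b i) - p (a i))).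
    by apply: eq_bigr => i _; rewrite dee // sign1_sqr ?mul1r //; have [] := sP i (ltn_ord i).
  rewrite sumrB /a /b /k.
  have -> : \sum_(i < size es) p (nth v0 (rot 1 vs) i) = \sum_(v <- rot 1 vs) p v.
    by rewrite (big_nth v0) big_mkord size_rot svs.
  have -> : \sum_(i < size es) p (nth v0 vs i) = \sum_(v <- vs) p v.
    by rewrite (big_nth v0) big_mkord svs.
  by rewrite (perm_big vs) ?perm_rot //= subrr.
- move=> e; rewrite /d; case: ifP => h; last by left.
  by right; have [] := sP (index e es) _; rewrite // index_mem.
- by rewrite SE; apply/set0Pn; exists e0; rewrite inE.
- move=> y /flowP fy yS; pose t i := y (ee i) * s i.
  have tS i : (i.+1 < k)%N -> t i.+1 = t i.
    move=> ik; have := fy (fun v => (a i.+1 == v)%:R); rewrite (pe _ _ yS).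
    have aE m : (m < k)%N -> (a i.+1 == a m) = (i.+1 == m).
      by move=> mk; rewrite nth_uniq // svs.
    have bE m : (m < k)%N -> (a i.+1 == b m) = (i == m).
      move=> mk; rewrite bS //; case: ifP => h; first by rewrite aE // eqSS.
      rewrite aE; last by apply: leq_trans mk.
      by apply/esym/negP=> /eqP im; rewrite -im ik in h.
    have ik' : (i < k)%N by apply: ltnW.
    rewrite (bigD1 (Ordinal ik)) //= (bigD1 (Ordinal ik')) /=; last by rewrite -val_eqE /= (ltn_eqF (ltnSn i)).
    rewrite big1 => [|m]; last first.
      rewrite -!val_eqE /= => /andP [m1 m2]; rewrite aE // bE // eq_sym (negPf m2) eq_sym (negPf m1).
      by rewrite subrr mulr0.
    rewrite !aE // !bE // !eqxx (gtn_eqF (ltnSn i)) (ltn_eqF (ltnSn i)) -/(t i) -/(t i.+1).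
    by rewrite /= ?mulr1n ?mulr0n => h; lra.
  have t0 i : (i < k)%N -> t i = t 0%N.
    by elim: i => // i IH ik; rewrite tS // IH // ltnW.
  exists (t 0%N) => e; have [h|h] := boolP (e \in es); last first.
    rewrite /d (negPf h) mulr0; apply/eqP/negPn/negP=> ye.
    by have := subsetP yS e; rewrite SE !inE (negPf h) => /(_ ye).
  have ik : (index e es < k)%N by rewrite index_mem.
  rewrite /d h -(t0 _ ik) /t /ee nth_index // -mulrA sign1_sqr ?mulr1 //.
  by have [] := sP _ ik.
Qed.

Lemma cycle_circuit S : is_cycle S -> circuit flow S.
Proof.
move=> /cycle_vec [d [fd sd <- S0 dmin]]; split=> //; first by exists d.
move=> y fy /(dmin y fy) [c yc]; have [c0|c0] := eqVneq c 0; [left|right];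
  apply/setP=> e; rewrite !inE yc ?c0 ?mul0r ?eqxx //.
by rewrite mulf_eq0 (negPf c0).
Qed.

Lemma flow_unimodular : unimodular flow.
Proof.
split; first exact: flow_lin.
move=> x fx x0; have [d [fd sd Cd cd]] := direct_cycle fx x0.
by exists d; split=> //; apply: cycle_circuit.
Qed.

Lemma is_cycleP S : is_cycle S <-> circuit flow S.
Proof.
split; first exact: cycle_circuit.
case=> -[x fx <-] x0 xmin; have [d [fd sd Cd cd]] := direct_cycle fx x0.
have [d0|dx] := xmin d fd (conformal_supp cd); last by rewrite -dx.
by have [d' [_ _ _ /eqP]] := cycle_vec Cd; rewrite d0.
Qed.

End Flow.

(** * Flows on a connected graph: separating edges, C1-sets and cuts *)

Section Connected.
Variable C : tgraph.
Implicit Types (x y z d : tE C -> R) (p : tV C -> R) (e f : tE C).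

Lemma nonsep_flow e : ~ separating e -> exists2 x, flow x & x e = 1.
Proof.
move=> /NNPP cn; have [z zs zp] := path_flow (cn (ttgt C e) (tsrc C e) isT isT).
exists (fun f => z f + 1 * (e == f)%:R).
  by apply/flowP=> p; rewrite pairingD zp pairing_delta; ring.
rewrite eqxx mul1r; suff -> : z e = 0 by rewrite add0r.
by apply/eqP/negPn/negP=> /zs [] /=; rewrite eqxx.
Qed.

Hypothesis cC : graph_connected C.

Lemma const_pot p a b : (forall e, p (ttgt C e) = p (tsrc C e)) -> p a = p b.
Proof. by move=> pe; apply: pot_const (cC.2 a b isT isT) => e _ _ _. Qed.

(** Pair [x] with the indicator of a component of the graph without [e]: only [e] contributes. *)
Lemma sep_flow e x : separating e -> flow x -> x e = 0.
Proof.
move=> sep /flowP fx.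
have [a nab] : exists a, ~ forall b, connect (adj_in (predC1 e) predT) a b.
  by apply: contrapT => h; apply: sep => a b _ _; apply: contrapT => h'; apply: h; exists a => h0; exact: h' (h0 b).
pose p v : R := (connect (adj_in (predC1 e) predT) a v)%:R.
have pf f : f != e -> p (ttgt C f) = p (tsrc C f).
  move=> fe; have lk u v : joins f u v -> connect (adj_in (predC1 e) predT) u v.
    by move=> j; apply: connect1; apply/existsP; exists f; rewrite /= fe.
  have h1 : connect (adj_in (predC1 e) predT) (tsrc C f) (ttgt C f) by apply: lk; rewrite /joins !eqxx.
  have h2 : connect (adj_in (predC1 e) predT) (ttgt C f) (tsrc C f) by apply: lk; rewrite /joins !eqxx orbT.
  by rewrite /p; congr (nat_of_bool _)%:R; apply/idP/idP=> h; apply: connect_trans h _.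
have := fx p; rewrite /pairing (bigD1 e) //= big1 => [|f fe]; last by rewrite pf // subrr mulr0.
rewrite addr0 => /eqP; rewrite mulf_eq0 => /orP [/eqP //|]; rewrite subr_eq0 => /eqP pe.
exfalso; apply: nab => b; have : p a = p b.
  by apply: const_pot => f; have [->|/pf] := eqVneq f e.
rewrite /p connect0; case: connect => // /eqP; by rewrite oner_eq0.
Qed.

(** Subtract from [x] the multiple of a signed cycle through [e] that clears [e]. If [f] survived,
    the difference would contain a cycle through [f] that avoids [e]. *)
Lemma same_cycles_flow e f : same_cycles e f -> ~ separating e ->
  exists2 c : R, sign1 c & forall x, flow x -> x f = c * x e.
Proof.
move=> ef /nonsep_flow [x0 fx0 x0e].
have UL := flow_unimodular C.
have x0e0 : x0 e != 0 by rewrite x0e oner_neq0.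
have [d [fd sd Cd _ de]] := circuit_through UL fx0 x0e0.
have df : d f != 0.
  by have [+ _] := ef _ ((is_cycleP _).2 Cd); rewrite !inE; apply.
exists (d f * d e) => [|x fx]; first by apply: sign1M; apply: signvec_neq0.
pose z g := x g + (- (x e * d e)) * d g.
have fz : flow z by apply: lin_closedD UL.1 fx fd.
have ze : z e = 0.
  by rewrite /z mulNr -mulrA (sign1_sqr (signvec_neq0 sd de)) mulr1 subrr.
have zf : z f = 0.
  apply/eqP/negPn/negP=> zf; have [d' [fd' sd' Cd' /conformal_supp/subsetP cd' df']] := circuit_through UL fz zf.
  have [_ h] := ef _ ((is_cycleP _).2 Cd'); move: h; rewrite !inE => /(_ df') de'.
  by have := cd' e; rewrite !inE de' ze eqxx => /(_ isT).
by move: zf; rewrite /z mulNr => /subr0_eq ->; ring.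
Qed.

Lemma flow_same_cycles e f (c : R) : c != 0 -> (forall x, flow x -> x f = c * x e) ->
  same_cycles e f.
Proof.
move=> c0 h S /cycle_vec [d [fd _ <- _ _]]; rewrite !inE h // mulf_eq0 (negPf c0) /=.
by [].
Qed.

(** The orthogonal complement of the flows is the cut space: integrate [u] along a chosen walk from
    a root to each vertex. For an edge, the two walks to its ends and the edge itself form a
    flow. *)
Lemma cut_pot (u : tE C -> R) : (forall x, flow x -> \sum_e u e * x e = 0) ->
  exists p, forall e, u e = p (ttgt C e) - p (tsrc C e).
Proof.
move=> uo; have [/card_gt0P [r _] cn] := cC.
have ex v : exists z, forall p, pairing z p = p v - p r.
  by have [z _ zp] := path_flow (cn r v isT isT); exists z.
have [z zP] := boolp.choice ex.
exists (fun v => \sum_e u e * z v e) => e.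
pose y f := (z (tsrc C e) f + 1 * (e == f)%:R) + (-1) * z (ttgt C e) f.
have fy : flow y by apply/flowP=> p; rewrite !pairingD !zP pairing_delta; ring.
have := uo y fy; rewrite /y.
have -> : \sum_f u f * (z (tsrc C e) f + 1 * (e == f)%:R + -1 * z (ttgt C e) f) =
   \sum_f u f * z (tsrc C e) f + \sum_f u f * (e == f)%:R - \sum_f u f * z (ttgt C e) f.
  by rewrite -sumrN -!big_split /=; apply: eq_bigr => f _; ring.
by rewrite sum_delta => h; lra.
Qed.

End Connected.

(** * The first Betti number as the dimension of the flow space *)

Section Betti.

Definition vec (T : finType) (x : T -> R) : 'rV[R]_#|T| := \row_i x (enum_val i).
Definition unvec (T : finType) (u : 'rV[R]_#|T|) : T -> R := fun t => u 0 (enum_rank t).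

Lemma unvecK (T : finType) (u : 'rV[R]_#|T|) : vec (unvec u) = u.
Proof. by apply/rowP=> i; rewrite mxE /unvec enum_valK. Qed.

Definition bdmx (C : tgraph) : 'M[R]_(#|tE C|, #|tV C|) :=
  \matrix_(i, j) ((enum_val j == ttgt C (enum_val i))%:R - (enum_val j == tsrc C (enum_val i))%:R).

Lemma sum_enum_val (T : finType) (F : T -> R) : \sum_(i < #|T|) F (enum_val i) = \sum_t F t.
Proof. by rewrite [RHS](reindex _ (onW_bij _ (@enum_val_bij T))). Qed.

Lemma flow_bdmx (C : tgraph) (x : tE C -> R) : flow x <-> vec x *m bdmx C = 0.
Proof.
have E j : (vec x *m bdmx C) 0 j = bd x (enum_val j).
  rewrite bdE /pairing mxE -(sum_enum_val (fun e => x e * _)).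
  by apply: eq_bigr => i _; rewrite !mxE.
split=> [fx|h v]; first by apply/rowP=> j; rewrite E fx mxE.
by have := E (enum_rank v); rewrite h mxE enum_rankK.
Qed.

Lemma rank_bdmx (C : tgraph) : graph_connected C -> \rank (bdmx C) = #|tV C|.-1.
Proof.
move=> cC; have V0 := cC.1.
have : \rank (kermx (bdmx C)^T) = 1%N.
  pose one : 'rV[R]_#|tV C| := const_mx 1.
  have -> : 1%N = \rank one.
    rewrite rank_rV; suff -> : one != 0 by [].
    by apply/eqP=> /rowP /(_ (Ordinal V0)); rewrite !mxE => /eqP; rewrite oner_eq0.
  apply/eqmx_rank/andP; split.
    apply/row_subP=> i; set p := row i _.
    have pk : p *m (bdmx C)^T = 0 by rewrite -row_mul mulmx_ker row0.
    move: p pk => p pk.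
    have pe e : unvec p (ttgt C e) = unvec p (tsrc C e).
      have /rowP /(_ (enum_rank e)) := pk; rewrite !mxE.
      have -> : \sum_j p 0 j * (bdmx C)^T j (enum_rank e) =
          \sum_(j < #|tV C|) (fun v => unvec p v * (ttgt C e == v)%:R - unvec p v * (tsrc C e == v)%:R) (enum_val j).
        by apply: eq_bigr => j _; rewrite /= !mxE enum_rankK /unvec enum_valK mulrBr !(eq_sym (enum_val j)).
      rewrite (sum_enum_val (fun v => unvec p v * (ttgt C e == v)%:R - unvec p v * (tsrc C e == v)%:R)).
      by rewrite sumrB !sum_delta => /subr0_eq.
    have [r _] := card_gt0P V0.
    have -> : p = unvec p r *: one.
      apply/rowP=> j; rewrite !mxE mulr1.
      by have := const_pot cC (enum_val j) r pe; rewrite {1}/unvec enum_valK.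
    exact: scalemx_sub.
  apply/sub_kermxP/rowP=> i; rewrite !mxE.
  rewrite (eq_bigr (fun j => (fun v => 1 * (ttgt C (enum_val i) == v)%:R - 1 * (tsrc C (enum_val i) == v)%:R) (enum_val j))).
    rewrite (sum_enum_val (fun v => 1 * (ttgt C (enum_val i) == v)%:R - 1 * (tsrc C (enum_val i) == v)%:R)).
    by rewrite sumrB !(sum_delta (fun=> 1)) subrr.
  by move=> j _; rewrite !mxE mul1r !(eq_sym (enum_val j)) !mul1r.
by rewrite mxrank_ker mxrank_tr; have := rank_leq_col (bdmx C); lia.
Qed.

(** Guarantees that the subtraction of natural numbers in [b1] does not truncate. *)
Lemma card_V_le (C : tgraph) : graph_connected C -> (#|tV C| <= #|tE C| + 1)%N.
Proof. by move=> cC; have := rank_leq_row (bdmx C); rewrite rank_bdmx //; lia. Qed.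

Lemma b1_rank (C : tgraph) : graph_connected C -> b1 C = \rank (kermx (bdmx C)).
Proof.
move=> cC; rewrite mxrank_ker rank_bdmx // /b1; have := card_V_le cC; have [V0 _] := cC.
by lia.
Qed.

Lemma b1_le (C C' : tgraph) (h : (tE C -> R) -> (tE C' -> R)) :
  graph_connected C -> graph_connected C' ->
  (forall x, flow x -> flow (h x)) ->
  (forall x y c, flow x -> flow y -> h (fun e => x e + c * y e) = fun e => h x e + c * h y e) ->
  (forall x, flow x -> h x = (fun=> 0) -> x = fun=> 0) ->
  (b1 C <= b1 C')%N.
Proof.
move=> cC cC' hf hlin hinj; rewrite !b1_rank //.
set K := row_base (kermx (bdmx C)).
have Kf i : flow (unvec (row i K)).
  apply/flow_bdmx; rewrite unvecK; apply/sub_kermxP.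
  by apply: submx_trans (row_sub i K) _; rewrite eq_row_base.
pose M := \matrix_i vec (h (unvec (row i K))).
have h0 : h (fun=> 0) = fun=> 0.
  have := hlin _ _ (-1) (flow_lin C).1 (flow_lin C).1.
  have E : (fun e : tE C => GRing.add 0 (-1 * 0)) = (fun=> GRing.zero) :> (tE C -> R) by apply/funext=> e; rewrite mulr0 addr0.
  by rewrite E => {1}->; apply/funext=> e; rewrite mulN1r subrr.
have hsum (I : Type) (r : seq I) (c : I -> R) (g : I -> tE C -> R) : (forall i, flow (g i)) ->
    h (fun e => \sum_(i <- r) c i * g i e) = fun e => \sum_(i <- r) c i * h (g i) e.
  move=> fg; elim: r => [|i r IH].
    have -> : (fun e => \sum_(i <- [::]) c i * g i e) = fun=> 0 by apply/funext=> e; rewrite big_nil.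
    by rewrite h0; apply/funext=> e; rewrite big_nil.
  have -> : (fun e => \sum_(k <- i :: r) c k * g k e) = fun e => \sum_(k <- r) c k * g k e + c i * g i e.
    by apply/funext=> e; rewrite big_cons addrC.
  rewrite hlin //; last by apply: lin_closed_sum; first exact: flow_lin.
  by rewrite IH; apply/funext=> e; rewrite big_cons addrC.
have MB : (M <= kermx (bdmx C'))%MS.
  apply/row_subP=> i; rewrite rowK; apply/sub_kermxP/flow_bdmx/hf/Kf.
have -> : \rank (kermx (bdmx C)) = \rank M; last exact: mxrankS.
apply/esym/eqP; rewrite -/(row_free M); apply/inj_row_free => u uM.
have KE : unvec (u *m K) = fun e => \sum_i u 0 i * unvec (row i K) e.
  by apply/funext=> e; rewrite /unvec mxE; apply: eq_bigr => i _; rewrite [row i K _ _]mxE.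
have : unvec (u *m K) = fun=> 0.
  apply: hinj; first by rewrite KE; apply: lin_closed_sum; [exact: flow_lin|].
  rewrite KE hsum //; apply/funext=> e; have /rowP /(_ (enum_rank e)) := uM.
  rewrite mxE [RHS]mxE => uMe; apply: etrans uMe; apply: eq_bigr => i _.
  by rewrite [M _ _]mxE [vec _ _ _]mxE enum_rankK.
move=> /(congr1 (@vec _)); rewrite unvecK => uK.
have {}uK : u *m K = 0 by rewrite uK; apply/rowP=> j; rewrite !mxE.
by apply: (row_free_inj (row_base_free (kermx (bdmx C)))); rewrite -/K uK mul0mx.
Qed.

End Betti.

(** * Flows on the 3-edge-connectivization *)

Section Conn3Flow.
Variables (C : tgraph) (Rp : {set tE C}).
Hypotheses (cC : graph_connected C) (hR : is_rep Rp).
Implicit Types (x : tE C -> R) (y : tE (conn3 Rp) -> R).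

Definition res x : tE (conn3 Rp) -> R := fun e : E3 Rp => x (val e).

Lemma cadj_connect_sym : connect_sym (cadj Rp).
Proof. exact: sym_connect_sym (cadj_sym Rp). Qed.

Lemma to3_contracted e : e \notin Rp -> to3 Rp (ttgt C e) = to3 Rp (tsrc C e).
Proof.
move=> eR; apply: val_inj; apply/eqP; rewrite /= /croot (root_connect cadj_connect_sym) connect1 //.
by apply/existsP; exists e; rewrite /contracted eR /joins !eqxx orbT.
Qed.

(** A potential on the contracted graph is one on the original graph that is constant on contracted
    classes, so contracted edges contribute nothing. *)
Lemma pairing_res x (p : tV (conn3 Rp) -> R) : pairing (res x) p = pairing x (fun v => p (to3 Rp v)).
Proof.
rewrite /pairing [RHS](bigID (fun e => e \in Rp)) /= [X in _ + X]big1 => [|e eR].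
  rewrite addr0 (big_sub (fun e => e \in Rp) (fun e => x e * (p (to3 Rp (ttgt C e)) - p (to3 Rp (tsrc C e))))).
  by [].
by rewrite to3_contracted // subrr mulr0.
Qed.

Lemma res_flow x : flow x -> flow (res x).
Proof. by move=> /flowP fx; apply/flowP=> p; rewrite pairing_res fx. Qed.

Lemma rep_coef f : (forall x, flow x -> x f = 0) \/
  exists e : E3 Rp, exists2 c : R, sign1 c & forall x, flow x -> x f = c * x (val e).
Proof.
have [sf|nf] := boolp.EM (separating f); first by left=> x; apply: sep_flow.
right; have [_ h _] := hR; have [e eR sc] := h f nf.
have [c sc1 hc] := same_cycles_flow sc nf; exists (exist _ e eR); exists c => // x fx /=.
by rewrite hc // mulrA sign1_sqr ?mul1r.
Qed.

Lemma res_inj x x' : flow x -> flow x' -> res x = res x' -> x = x'.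
Proof.
move=> fx fx' E; apply/funext=> f; have [h|[e [c _ h]]] := rep_coef f; first by rewrite !h.
by rewrite !h //; have /(congr1 (fun t => t e)) := E; rewrite /res => ->.
Qed.

(** Extend [y] by 0, then send the excess of every vertex to the root of its class through
    contracted edges. This leaves the edges of [Rp] untouched, and the excesses collected at a root
    cancel because [y] is a flow. *)
Lemma res_surj y : flow y -> exists2 x, flow x & res x = y.
Proof.
move=> /flowP fy.
pose x0 e := if @insub _ (fun e => e \in Rp) (E3 Rp) e is Some e' then y e' else 0.
have rx0 : res x0 = y by apply/funext=> e; rewrite /res /x0 valK.
have ex v : exists z, (forall e, z e != 0 -> contracted Rp e) /\
    forall p, pairing z p = p (croot Rp v) - p v.
  have [z zs zp] := path_flow (connect_root (cadj Rp) v).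
  by exists z; split=> // e /zs [].
have [z zP] := boolp.choice ex.
exists (fun e => x0 e + 1 * \sum_v bd x0 v * z v e); last first.
  apply/funext=> e; rewrite /res big1 ?mulr0 ?addr0 => [|v _]; first by rewrite -rx0.
  suff -> : z v (val e) = 0 by rewrite mulr0.
  by apply/eqP/negPn/negP=> /((zP v).1); rewrite /contracted (valP e).
apply/flowP=> p; rewrite pairingD mul1r.
have -> : pairing (fun e => \sum_v bd x0 v * z v e) p = \sum_v bd x0 v * pairing (z v) p.
  rewrite /pairing; under eq_bigr do rewrite mulr_suml.
  rewrite exchange_big; apply: eq_bigr => v _ /=; rewrite mulr_sumr.
  by apply: eq_bigr => e _; rewrite mulrA.
rewrite -sum_bd -big_split /=.
transitivity (\sum_v p (croot Rp v) * bd x0 v).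
  by apply: eq_bigr => v _; rewrite (zP v).2; ring.
rewrite (sum_bd x0 (fun v => p (croot Rp v))) -(fy (fun r : V3 Rp => p (val r))) -rx0 pairing_res.
by [].
Qed.

Lemma rep_class (e : E3 Rp) f : same_cycles (val e) f ->
  exists2 c : R, sign1 c & forall x, flow x -> x f = c * x (val e).
Proof.
move=> sc; apply: same_cycles_flow sc _.
by have [h _ _] := hR; apply: h; apply: valP.
Qed.

(** Separating edges carry no flow and a C1-set carries one value up to sign, so grouping the
    squares by C1-sets collects the lengths into [l3]. *)
Lemma Q_res x : flow x -> \sum_f x f * x f * tl C f = \sum_e res x e * res x e * tl (conn3 Rp) e.
Proof.
move=> fx; have [h1 h2 h3] := hR.
transitivity (\sum_(e : E3 Rp) \sum_(f | pbool (~ separating f /\ same_cycles (val e) f)) x f * x f * tl C f).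
  rewrite (exchange_big_dep predT) //=; apply: eq_bigr => f _.
  have [sf|nf] := boolp.EM (separating f).
    rewrite sep_flow // !mul0r big1 //.
  have [e eR sc] := h2 f nf; rewrite (big_pred1 (exist _ e eR : E3 Rp)) // => e' /=.
  apply/pboolP/eqP=> [[_ sc']|->]; last by split=> // S cS; have := sc S cS; tauto.
  apply: val_inj => /=; apply: h3 (valP e') eR _ => S cS.
  by have := sc S cS; have := sc' S cS; tauto.
apply: eq_bigr => e _; rewrite /= /l3 /res.
rewrite (_ : \big[Rplus/R0]_(f | _) tl C f = \sum_(f | pbool (~ separating f /\ same_cycles (val e) f)) tl C f) //.
rewrite mulr_sumr; apply: eq_bigr => f /pboolP [_ sc].
have [c c1 ->] := rep_class sc => //.
by rewrite mulrACA sign1_sqr ?mul1r.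
Qed.

End Conn3Flow.

(** * 2-isomorphisms as signed isomorphisms of flow spaces *)

Section Pull.
Variables (F : realFieldType) (E E' : finType) (phi : E -> E') (psi : E' -> E).
Hypotheses (phiK : cancel phi psi) (psiK : cancel psi phi).
Variable L' : (E' -> F) -> Prop.

Definition pull : (E -> F) -> Prop := fun y => L' (fun e' => y (psi e')).

Lemma supp_pull (y : E -> F) : supp (fun e' => y (psi e')) = phi @: supp y.
Proof.
apply/setP=> e'; rewrite inE; apply/idP/imsetP=> [h|[e]].
  by exists (psi e'); rewrite ?inE ?psiK.
by rewrite inE => h ->; rewrite phiK.
Qed.

Lemma pushK (y : E' -> F) : (fun e' => y (phi (psi e'))) = y.
Proof. by apply/funext=> e'; rewrite psiK. Qed.

Lemma pull_push (y : E' -> F) : L' y <-> pull (fun e => y (phi e)).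
Proof. by rewrite /pull pushK. Qed.

Lemma supp_push (y : E' -> F) : supp y = phi @: supp (fun e => y (phi e)).
Proof. by rewrite -supp_pull pushK. Qed.

Lemma pull_circuit (S : {set E}) : circuit pull S <-> circuit L' (phi @: S).
Proof.
have inj := can_inj phiK; have iinj := imset_inj inj.
have i0 (T : {set E}) : (phi @: T == set0) = (T == set0).
  by rewrite -(inj_eq iinj) imset0.
split=> -[[x Lx xS] S0 Smin].
- split; first by exists (fun e' => x (psi e')); rewrite // supp_pull xS.
    by rewrite i0.
  move=> y /pull_push Ly; rewrite (supp_push y) => sub.
  have [|->|->] := Smin _ Ly; last by right.
    by apply/subsetP=> e eS; have := subsetP sub _ (imset_f phi eS); rewrite mem_imset.
  by left; rewrite imset0.
- split; last 1 first.
  + move=> y Ly sub; have [|h|h] := Smin _ Ly; first by rewrite supp_pull imsetS.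
      by left; apply/eqP; rewrite -i0 -supp_pull h.
    by right; apply: iinj; rewrite -supp_pull.
  + exists (fun e => x (phi e)); first exact: (pull_push x).1.
    by apply: iinj; rewrite /= -supp_push.
  + by rewrite -i0.
Qed.

Lemma pull_unimodular : unimodular L' -> unimodular pull.
Proof.
move=> [[L0 LD] U]; split; first by split=> // x y c Lx Ly; apply: LD.
move=> x Lx x0; have [|d [Ld sd Cd cd]] := U _ Lx.
  by rewrite supp_pull; apply: contra_neq x0 => h; apply: (imset_inj (can_inj phiK)); rewrite imset0.
exists (fun e => d (phi e)); split.
- exact: (pull_push d).1.
- by move=> e; apply: sd.
- by apply/pull_circuit; rewrite -supp_push.
- by move=> e /cd; rewrite phiK.
Qed.
End Pull.

Definition signed_iso_by (D D' : tgraph) (phi : tE D -> tE D') (psi : tE D' -> tE D)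
    (eps : tE D -> R) : Prop :=
  [/\ cancel phi psi /\ cancel psi phi, forall e, tl D' (phi e) = tl D e,
      forall e, sign1 (eps e) &
      forall x : tE D' -> R, flow x <-> flow (fun e => eps e * x (phi e))].

Definition signed_iso (D D' : tgraph) : Prop :=
  exists phi psi eps, @signed_iso_by D D' phi psi eps.

Lemma signed_iso_by_sym D D' phi psi eps : @signed_iso_by D D' phi psi eps ->
  @signed_iso_by D' D psi phi (fun e' => eps (psi e')).
Proof.
case=> [[K1 K2] ll se fl]; split=> //; first by move=> e'; rewrite -ll K2.
move=> x; rewrite fl; have -> // : (fun e => eps e * (eps (psi (phi e)) * x (psi (phi e)))) = x.
by apply/funext=> e; rewrite K1 mulrA sign1_sqr ?mul1r.
Qed.

Lemma two_isoP D D' : two_iso D D' <-> signed_iso D D'.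
Proof.
split.
- case=> phi [[psi K1 K2] ll cyc cyc'].
  have inj := can_inj K1.
  have UL := flow_unimodular D; have UL' := pull_unimodular K1 K2 (flow_unimodular D').
  have [|eps se epsP] := unimodular_signing UL UL'.
    move=> S; split=> [/is_cycleP/cyc/is_cycleP|].
      by move=> /(pull_circuit K1 K2).
    move=> /(pull_circuit K1 K2)/is_cycleP/cyc' [S2 cS2 E].
    by rewrite -(imset_inj inj E); apply/is_cycleP.
  exists phi, psi, eps; split=> // x; rewrite epsP /pull.
  have -> // : (fun e' => eps (psi e') * (eps (psi e') * x (phi (psi e')))) = x.
  by apply/funext=> e'; rewrite K2 mulrA sign1_sqr ?mul1r.
- case=> phi [psi [eps [[K1 K2] ll se fl]]].
  have E : pull psi (@flow D') = twist eps (@flow D).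
    apply/funext=> y; apply/propext; rewrite /pull /twist fl.
    by have -> : (fun e => eps e * y (psi (phi e))) = (fun e => eps e * y e) by apply/funext=> e; rewrite K1.
  have cE S : is_cycle S <-> is_cycle (phi @: S).
    by rewrite !is_cycleP -(pull_circuit K1 K2) E twist_circuit.
  exists phi; split=> //; first by exists psi.
    by move=> S /cE.
  move=> S' cS'; exists (psi @: S'); last first.
    by rewrite -imset_comp (eq_imset (g := id)) ?imset_id // => e; rewrite /= K2.
  by apply/cE; rewrite -imset_comp (eq_imset (g := id)) ?imset_id // => e; rewrite /= K2.
Qed.

(** * Kinks of weighted sums of absolute values *)

Section Kink.
Variables (F : realFieldType) (E I : finType) (f : I -> (E -> F) -> F).
Implicit Types (K : (E -> F) -> Prop) (A : (E -> F) -> F).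

Definition linear_on K A := forall x y c, K x -> K y -> A (fun e => x e + c * y e) = A x + c * A y.

Lemma small_scale (s : seq I) (a b : I -> F) : (forall i, i \in s -> 0 < b i) ->
  exists2 t, 0 < t & forall i, i \in s -> t * `|a i| < b i.
Proof.
elim: s => [|i s IH] bp; first by exists 1.
have [j js|t t0 tP] := IH; first by apply: bp; rewrite inE js orbT.
have bi : 0 < b i by apply: bp; rewrite inE eqxx.
have a1 : 0 < `|a i| + 1 by rewrite ltr_wpDl.
(* The [+ 1] keeps the denominator positive when [a i] is 0 and makes the inequality strict. *)
pose u := b i / (`|a i| + 1); have u0 : 0 < u by rewrite divr_gt0.
exists (Num.min t u) => [|j]; first by rewrite lt_min t0.
have mt : Num.min t u <= t by rewrite ge_min lexx.
have mu : Num.min t u <= u by rewrite ge_min lexx orbT.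
rewrite inE => /orP [/eqP ->|js].
  apply: le_lt_trans (_ : u * `|a i| < b i); first by rewrite ler_wpM2r.
  by rewrite /u mulrAC ltr_pdivrMr // ltr_pM2l // ltrDl.
by apply: le_lt_trans (tP j js); rewrite ler_wpM2r.
Qed.

(** Finitely many proper hyperplanes do not cover a space: a small enough perturbation leaves one
    more of them without falling back onto the others. *)
Lemma generic_point K (s : seq I) : lin_closed K -> (forall i, linear_on K (f i)) ->
  (forall i, i \in s -> exists2 x, K x & f i x != 0) ->
  exists2 x, K x & forall i, i \in s -> f i x != 0.
Proof.
move=> KK fl; elim: s => [|i s IH] ex; first by exists (fun=> 0) => //; apply: KK.1.
have [j js|x Kx xP] := IH; first by apply: ex; rewrite inE js orbT.
have [y Ky yi] := ex i (mem_head _ _).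
have [xi|xi] := eqVneq (f i x) 0; last first.
  by exists x => // j; rewrite inE => /orP [/eqP ->|/xP].
have [j js|t t0 tP] := @small_scale s (fun j => f j y) (fun j => `|f j x|).
  by rewrite normr_gt0 xP.
exists (fun e => x e + t * y e) => [|j]; first by apply: KK.2.
rewrite inE fl // => /orP [/eqP ->|js]; first by rewrite xi add0r mulf_neq0 // gt_eqF.
have := tP j js; apply: contraTneq => /eqP; rewrite addr_eq0 => /eqP ->.
by rewrite normrN normrM (gtr0_norm t0) ltxx.
Qed.

Lemma norm_flat (a b : F) : `|b| < `|a| -> `|a + b| + `|a - b| = `|a| + `|a|.
Proof.
by case: (ger0P a) => ?; case: (ger0P b) => ?;
  case: (ger0P (a + b)) => ?; case: (ger0P (a - b)) => ?; lra.
Qed.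

(* Second difference in direction [v] at a generic point of the hyperplane [A = 0]: only the
   terms whose functional is a multiple of [A] contribute. *)
Lemma kink K A (m : I -> F) v : lin_closed K -> (forall i, linear_on K (f i)) -> linear_on K A ->
  (forall x, K x -> \sum_i m i * `|f i x| = 0) -> K v ->
  \sum_(i | pbool (forall x, K x -> A x = 0 -> f i x = 0)) m i * `|f i v| = 0.
Proof.
move=> KK fl Al sum0 Kv; pose good i := pbool (forall x, K x -> A x = 0 -> f i x = 0).
pose K0 x := K x /\ A x = 0.
have A0 : A (fun=> 0) = 0.
  have h := Al _ _ (-1) KK.1 KK.1.
  have E0 : (fun e : E => 0 + -1 * 0) = (fun=> 0 : F) by apply/funext=> e; rewrite mulr0 addr0.
  by rewrite E0 in h; lra.
have KK0 : lin_closed K0.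
  split; first by split=> //; apply: KK.1.
  by move=> x y c [Kx Ax] [Ky Ay]; split; [apply: KK.2 | rewrite Al // Ax Ay mulr0 addr0].
have fl0 i : linear_on K0 (f i) by move=> x y c [Kx _] [Ky _]; apply: fl.
have [i|x0 [Kx0 Ax0] x0P] := @generic_point K0 (enum [pred i | ~~ good i]) KK0 fl0.
  rewrite mem_enum inE => /pboolP ni; apply: contrapT => h; apply: ni => x Kx Ax.
  by apply/eqP/negPn/negP=> fx; apply: h; exists x.
have [i ig|t t0 tP] := @small_scale (enum [pred i | ~~ good i]) (fun j => f j v) (fun j => `|f j x0|).
  by rewrite normr_gt0 x0P.
have s1 := sum0 _ (KK.2 _ _ t Kx0 Kv); have s2 := sum0 _ (KK.2 _ _ (- t) Kx0 Kv).
have s3 := sum0 _ Kx0.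
have S : \sum_i m i * (`|f i x0 + t * f i v| + `|f i x0 - t * f i v| - (`|f i x0| + `|f i x0|)) = 0.
  transitivity (\sum_i m i * `|f i (fun e => x0 e + t * v e)| + \sum_i m i * `|f i (fun e => x0 e + - t * v e)|
    - (\sum_i m i * `|f i x0| + \sum_i m i * `|f i x0|)); last by rewrite s1 s2 s3 !addr0 subrr.
  rewrite -!big_split -sumrB; apply: eq_bigr => i _ /=; rewrite !fl // mulNr; ring.
move: S; rewrite (bigID good) /= [X in _ + X]big1 ?addr0 => [S|i ni].
  apply: (mulfI (lt0r_neq0 (addr_gt0 t0 t0))); rewrite mulr0 -[RHS]S mulr_sumr.
  apply: eq_bigr => i /pboolP gi; rewrite (gi x0) // !add0r normrN normr0 addr0 subr0.
  by rewrite normrM (gtr0_norm t0); ring.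
rewrite norm_flat ?subrr ?mulr0 // normrM (gtr0_norm t0); apply: tP.
by rewrite mem_enum inE.
Qed.
End Kink.

(** * Isometries of Jacobians preserve the weighted 1-norm *)

Section Jacobian.

Lemma lat_dich (a : R) : (exists z : Z, a = IZR z) -> [\/ a = 0, 1 <= a | a <= -1].
Proof.
case=> z ->; have [h|[->|h]] := Z.lt_trichotomy z Z0; [|by apply: Or31|].
  by apply: Or33; apply/RleP; apply: (IZR_le z (Zneg 1)); lia.
by apply: Or32; apply/RleP; apply: (IZR_le (Zpos 1) z); lia.
Qed.

Lemma lat_norm (a : R) : (exists z : Z, a = IZR z) -> `|a| <= a * a.
Proof.
by case/lat_dich=> [->|h|h]; [rewrite normr0 mulr0|rewrite ger0_norm; nra|rewrite ler0_norm; nra].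
Qed.

Lemma lat_unit (a b : R) : (exists z : Z, a = IZR z) -> (exists z : Z, b = IZR z) ->
  a * b = 1 -> sign1 a.
Proof.
move=> /lat_dich [->|ha|ha] /lat_dich [->|hb|hb]; rewrite ?mul0r ?mulr0 => h; rewrite /sign1.
all: try (exfalso; lra).
- by left; nra.
- by exfalso; nra.
- by exfalso; nra.
- by right; nra.
Qed.

Lemma lat_sign (a : R) : a = 0 \/ sign1 a -> exists z : Z, a = IZR z.
Proof. by case=> [->|[->|->]]; [exists Z0|exists (Zpos 1)|exists (Zneg 1)]. Qed.

Lemma lat_mul (a b : R) : (exists z : Z, a = IZR z) -> (exists z : Z, b = IZR z) ->
  exists z : Z, a * b = IZR z.
Proof. by case=> z1 -> [z2 ->]; exists (Z.mul z1 z2); rewrite mult_IZR. Qed.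

(** One direction of an isomorphism of Jacobians. The norm inequality holds for such a map alone;
    applied to a map and its inverse it becomes an equality. *)
Definition jmap (C C' : tgraph) (h : jvec C -> jvec C') : Prop :=
  [/\ forall x y c, inH1 x -> inH1 y -> h (fun j => x j + c * y j) = fun j => h x j + c * h y j,
      forall x, inH1 x -> inH1 (h x),
      forall x, inH1 x -> inLat x -> inLat (h x) &
      forall x, inH1 x -> Qform (h x) = Qform x].

Lemma inH1_lin (C : tgraph) : lin_closed (@inH1 C).
Proof.
split; first by apply/inH1E; apply: (flow_lin C).1.
by move=> x y c /inH1E fx /inH1E fy; apply/inH1E; apply: (flow_lin C).2.
Qed.

Lemma jac_isoP (C C' : tgraph) : jac_iso C C' <->
  exists h hi, [/\ jmap h, @jmap C' C hi, forall x, inH1 x -> hi (h x) = x &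
                   forall y, inH1 y -> h (hi y) = y].
Proof.
split.
- case=> h [[hD hZ] hH [hi hs] hL hQ].
  have hlin x y c : inH1 x -> inH1 y -> h (fun j => x j + c * y j) = fun j => h x j + c * h y j.
    move=> Hx Hy; have Hcy : inH1 (vscale c y) := lin_closedZ c (inH1_lin C) Hy.
    by have := hD x (vscale c y) Hx Hcy; rewrite hZ.
  have ex y : exists x, inH1 y -> inH1 x /\ h x = y.
    have [Hy|nHy] := boolp.EM (inH1 y); last by exists (fun=> 0).
    by have [x Hx <-] := hs y Hy; exists x.
  have [k kP] := boolp.choice ex.
  exists h, k; split.
  + by split=> // x Hx; case: (hL x Hx).
  + split.
    * move=> x y c Hx Hy; have [Hkx hkx] := kP x Hx; have [Hky hky] := kP y Hy.
      have Hxy := (inH1_lin C').2 x y c Hx Hy; have [Hk hk] := kP _ Hxy.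
      apply: hi => //; first exact: (inH1_lin C).2.
      by rewrite hk hlin // hkx hky.
    * by move=> y /kP [].
    * by move=> y Hy Ly; have [Hk hk] := kP y Hy; apply/hL; rewrite ?hk.
    * by move=> y Hy; have [Hk hk] := kP y Hy; rewrite -hQ // hk.
  + by move=> x Hx; have [Hk hk] := kP _ (hH x Hx); apply: hi.
  + by move=> y /kP [].
- case=> h [k [[hl hH hL hQ] [kl kH kL kQ] kh hk]]; exists h; split=> //.
  + split=> [x y Hx Hy|c x Hx].
      have := hl x y 1 Hx Hy; rewrite /vadd => E.
      transitivity (h (fun j => x j + 1 * y j)); first by congr h; apply/funext=> j; rewrite mul1r.
      by rewrite E; apply/funext=> j; rewrite mul1r.
    have H0 := (inH1_lin C).1; have h00 := hl _ _ (-1) H0 H0.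
    have E0 : (fun j : jcoord C => GRing.add 0 (-1 * 0)) = (fun=> GRing.zero) :> (jvec C).
      by apply/funext=> j; rewrite mulr0 addr0.
    rewrite E0 in h00.
    have h0 j : h (fun=> 0) j = 0 by have := congr1 (fun u => u j) h00; rewrite /= => E; lra.
    have := hl _ x c H0 Hx => E.
    transitivity (h (fun j => 0 + c * x j)); first by congr h; apply/funext=> j; rewrite add0r.
    by rewrite E; apply/funext=> j; rewrite h0 add0r.
  + split=> [x y Hx Hy E|y Hy]; first by rewrite -(kh x Hx) E kh.
    by exists (k y); [apply: kH|apply: hk].
  + move=> x Hx; split=> [Lx|Lhx]; first exact: hL.
    by rewrite -(kh x Hx); apply: kL => //; apply: hH.
Qed.

Definition edges (C : tgraph) (x : jvec C) : tE C -> R := fun e => x (inl e).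
Definition lift (C : tgraph) (d : tE C -> R) : jvec C := fun j => if j is inl e then d e else 0.

Lemma lift_inH1 (C : tgraph) (d : tE C -> R) : flow d -> inH1 (lift d).
Proof. by move=> fd; apply/inH1E. Qed.

Lemma lift_inLat (C : tgraph) (d : tE C -> R) : signvec d -> inLat (lift d).
Proof. by move=> sd [e|i] /=; [apply: lat_sign; apply: sd|exists Z0]. Qed.

Lemma QformE (C : tgraph) (x : jvec C) : Qform x = \sum_e edges x e * edges x e * tl C e.
Proof. by []. Qed.

Definition l1norm (C : tgraph) (u : tE C -> R) : R := \sum_e tl C e * `|u e|.

Section L1.
Variables (C C' : tgraph) (h : jvec C -> jvec C').
Hypotheses (l0 : forall e : tE C, 0 < tl C e) (l0' : forall e : tE C', 0 < tl C' e).
Hypothesis hj : jmap h.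

(* [l1norm x] is the minimum of [\sum c_i Q(g_i)] over the expressions [x = \sum c_i g_i] with
   [c_i >= 0] and [g_i] in the lattice: it only depends on the lattice and on [Q]. *)
Lemma l1norm_le x : inH1 x -> l1norm (edges (h x)) <= l1norm (edges x).
Proof.
have [hl hH hL hQ] := hj.
suff P u : flow u -> forall x, inH1 x -> edges x = u -> l1norm (edges (h x)) <= l1norm u.
  by move=> Hx; apply: P => //; apply/inH1E.
move=> fu; move: u fu; apply: (conformal_ind (flow_unimodular C)) => [{}x Hx x0|u d c fu fd sd _ c0 ud IH {}x Hx xE].
  (* Here [x] may still have weight coordinates. Its form is 0, so positivity of the lengths forces
     the edge part of [h x] to vanish. *)
  have Q0 : Qform (h x) = 0.
    by rewrite hQ // QformE x0 big1 // => e _; rewrite !mul0r.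
  have hx0 e : edges (h x) e = 0.
    have /eqP := Q0; rewrite QformE psumr_eq0 => [/allP /(_ e (mem_index_enum e))|{}e _].
      by rewrite /= mulf_eq0 (gt_eqF (l0' e)) orbF -expr2 sqrf_eq0 => /eqP.
    by apply: mulr_ge0; [rewrite -expr2 sqr_ge0 | apply: ltW].
  by rewrite /l1norm !big1 // => e _; rewrite ?hx0 normr0 mulr0.
have Hd := lift_inH1 fd; pose y j := x j + (- c) * lift d j.
have Hy : inH1 y by apply: (inH1_lin C).2.
have xy : x = fun j => y j + c * lift d j by apply/funext=> j; rewrite /y mulNr subrK.
have yu : edges y = u.
  apply/funext=> e; have := congr1 (fun t => t e) xE; rewrite /edges /y /= => ->; ring.
(* The image of [d] is integral, so its norm is at most its form; this equals the form of [d], which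
   is its norm since the entries are 0, 1, -1. *)
have dn : l1norm (edges (h (lift d))) <= l1norm d.
  apply: le_trans (_ : Qform (h (lift d)) <= _); last first.
    rewrite hQ // QformE; apply: ler_sum => e _; rewrite mulrC /edges /=.
    by rewrite ler_pM2l //; have [->|[->|->]] := sd e; rewrite ?normr0 ?normrN ?normr1; lra.
  rewrite QformE; apply: ler_sum => e _; rewrite mulrC ler_pM2r //; apply: lat_norm.
  exact: hL (lift_inLat sd) (inl e).
have -> : edges (h x) = fun e => edges (h y) e + c * edges (h (lift d)) e by rewrite {1}xy hl.
apply: le_trans (_ : l1norm (edges (h y)) + c * l1norm (edges (h (lift d))) <= _).
  rewrite /l1norm mulr_sumr -big_split; apply: ler_sum => e _ /=.
  rewrite mulrCA -mulrDr ler_pM2l //; apply: le_trans (ler_normD _ _) _.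
  by rewrite normrM (gtr0_norm c0).
apply: le_trans (_ : l1norm u + c * l1norm d <= _).
  by apply: lerD; [apply: IH|rewrite ler_pM2l].
rewrite /l1norm mulr_sumr -big_split; apply: ler_sum => e _ /=.
rewrite mulrCA -mulrDr ler_pM2l //; have := ud e; have [->|[->|->]] := sd e.
- by rewrite normr0 !mulr0 !addr0.
- by rewrite !mulr1 normr1 mulr1 => u0; rewrite !ger0_norm //; lra.
- by rewrite !mulrN1 normrN1 mulr1 oppr_ge0 => u0; rewrite !ler0_norm //; lra.
Qed.
End L1.
End Jacobian.

(** * Recovering the edges *)

Section Torelli.

Lemma eq_pbool (P Q : Prop) : (P <-> Q) -> pbool P = pbool Q.
Proof. by move=> PQ; apply/pboolP/pboolP => /PQ. Qed.

(** The size of the kink along [x r = 0]. The coordinates vanishing there are those of the C1-set of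
    [r], each equal to 1 or -1 on [v], and those of edges that carry no flow, which add nothing. *)
Lemma class_sum (C : tgraph) (r : tE C) (v : tE C -> R) :
  graph_connected C -> ~ separating r -> flow v -> sign1 (v r) ->
  \sum_(f | pbool (forall x, flow x -> x r = 0 -> x f = 0)) tl C f * `|v f| =
  \sum_(f | pbool (~ separating f /\ same_cycles r f)) tl C f.
Proof.
move=> cC nr fv vr; rewrite big_mkcond [RHS]big_mkcond; apply: eq_bigr => f _.
case: pboolP => [good|ngood]; case: pboolP => [[nf sc]|ncl] //.
- have [c c1 h] := same_cycles_flow sc nr; rewrite (h v fv) normrM.
  by case: c1 => ->; case: vr => ->; rewrite ?normrN normr1 !mulr1.
- suff -> : v f = 0 by rewrite normr0 mulr0.
  apply/eqP/negPn/negP=> vf; apply: ncl; split.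
    by move=> sf; rewrite (sep_flow cC sf fv) eqxx in vf.
  pose c0 := v f * v r.
  apply: (@flow_same_cycles _ _ _ c0); first by rewrite mulf_neq0 // sign1_neq0.
  move=> x fx; have fz := (flow_lin C).2 x v (- (x r * v r)) fx fv.
  have /eqP : x f + - (x r * v r) * v f = 0.
    by apply: good fz _; rewrite mulNr -mulrA sign1_sqr // mulr1 subrr.
  by rewrite mulNr subr_eq0 => /eqP ->; rewrite /c0; ring.
- exfalso; apply: ngood => x fx xr; have [c _ ->] := same_cycles_flow sc nr => //.
  by rewrite xr mulr0.
Qed.

Variables (C C' : tgraph) (Rp : {set tE C}) (Rp' : {set tE C'}).
Variables (h : jvec C -> jvec C') (k : jvec C' -> jvec C).
Hypotheses (cC : graph_connected C) (cC' : graph_connected C').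
Hypotheses (l0 : forall e : tE C, 0 < tl C e) (l0' : forall e : tE C', 0 < tl C' e).
Hypotheses (hR : is_rep Rp) (hR' : is_rep Rp').
Hypotheses (hj : jmap h) (kj : jmap k).
Hypotheses (hK : forall x, inH1 x -> k (h x) = x) (kK : forall y, inH1 y -> h (k y) = y).

(** The two norms have the same kink along the hyperplane where the coordinate of [e] vanishes. On
    the side of [C] its size is the positive length of [e], so some edge coordinate of [C'] must be
    a multiple of that of [e]. *)
Lemma edge_match (e : E3 Rp) : exists e' : E3 Rp', exists2 c : R, sign1 c &
  (forall x, inH1 x -> edges (h x) (val e') = c * edges x (val e)) /\
  tl (conn3 Rp') e' = tl (conn3 Rp) e.
Proof.
have [hl hH hL _] := hj; have [_ kH kL _] := kj.
have ne : ~ separating (val e) by have [h1 _ _] := hR; apply: h1 (valP e).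
have [v [fv sv ve]] : exists v, [/\ flow v, signvec v & v (val e) != 0].
  have [x0 fx0 x0e] := nonsep_flow ne.
  have [|d [fd sd _ _ de]] := circuit_through (e := val e) (flow_unimodular C) fx0.
    by rewrite x0e oner_neq0.
  by exists d.
have sve := signvec_neq0 sv ve.
have Hv := lift_inH1 fv; pose hv := edges (h (lift v)).
(* The difference of the two norms as one signed sum over both edge sets; it vanishes identically,
   as [kink] demands. *)
pose f (i : tE C + tE C') (x : jvec C) : R :=
  match i with inl e1 => edges x e1 | inr e1 => edges (h x) e1 end.
pose m (i : tE C + tE C') : R := match i with inl e1 => tl C e1 | inr e1 => - tl C' e1 end.
have fl i : linear_on (@inH1 C) (f i).
  by case: i => e1 x y c Hx Hy //=; rewrite hl.
have sum0 x : inH1 x -> \sum_i m i * `|f i x| = 0.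
  move=> Hx; rewrite big_sumType /=.
  have le1 := l1norm_le l0 l0' hj Hx; have := l1norm_le l0' l0 kj (hH x Hx).
  rewrite hK // => le2; have := le_anti (introT andP (conj le1 le2)); rewrite /l1norm => E.
  under [X in _ + X]eq_bigr do rewrite mulNr.
  by rewrite sumrN E subrr.
have Al : linear_on (@inH1 C) (fun x => edges x (val e)) by [].
pose good' f' := pbool (forall x, inH1 x -> edges x (val e) = 0 -> edges (h x) f' = 0).
have S0 : \sum_(f' | good' f') tl C' f' * `|hv f'| = tl (conn3 Rp) e.
  have := kink (inH1_lin C) fl Al sum0 Hv; rewrite big_sumType /=.
  under [X in _ + X]eq_bigr do rewrite mulNr.
  rewrite sumrN => /subr0_eq <-; apply: etrans (_ : _ = l3 e).
    rewrite /l3; apply: etrans (class_sum cC ne fv sve); apply: eq_bigl => f1.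
    apply: eq_pbool; split=> [good x fx xe|good x Hx xe]; first by apply: (good (lift x)); first exact: lift_inH1.
    by apply: (good (edges x)) => //; apply/inH1E.
  by [].
have l3_gt0 : 0 < tl (conn3 Rp) e.
  have -> : tl (conn3 Rp) e = \sum_(f | pbool (~ separating f /\ same_cycles (val e) f)) tl C f by [].
  rewrite (bigD1 (val e)) /=; last by apply/pboolP.
  by rewrite ltr_pwDl // sumr_ge0 // => f1 _; apply: ltW.
have [i gi hvi] : exists2 i, good' i & hv i != 0.
  apply: contrapT => no; move: l3_gt0; rewrite -S0 big1 ?ltxx // => i gi.
  have [->|hvi] := eqVneq (hv i) 0; first by rewrite normr0 mulr0.
  by exfalso; apply: no; exists i.
have goodE f' : good' f' -> forall x, inH1 x ->
    edges (h x) f' = (hv f' * v (val e)) * edges x (val e).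
  move=> /pboolP gf x Hx; pose c := - (edges x (val e) * v (val e)).
  have Hz := (inH1_lin C).2 x (lift v) c Hx Hv.
  have /eqP : edges (h (fun j => x j + c * lift v j)) f' = 0.
    apply: gf => //; rewrite /edges /c /= mulNr -mulrA (sign1_sqr sve).
    by rewrite mulr1 subrr.
  rewrite hl // /edges -/(edges (h (lift v)) f') -/hv /c mulNr subr_eq0 => /eqP ->.
  by rewrite /edges; ring.
have fhv : flow hv by apply/inH1E; apply: hH.
have ni : ~ separating i by move=> si; rewrite (sep_flow cC' si fhv) eqxx in hvi.
have lhv : exists z, hv i = IZR z by have := hL _ Hv (lift_inLat sv) (inl i).
pose c := hv i * v (val e).
(* [c] is an integer. Pulling back a signed cycle through [i] exhibits an integer inverse, so [c] is
   a unit. *)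
have c1 : sign1 c.
  have [x0 fx0 x0i] := nonsep_flow ni.
  have [|d [fd sd _ _ di]] := circuit_through (e := i) (flow_unimodular C') fx0.
    by rewrite x0i oner_neq0.
  have Hd := lift_inH1 fd; have := goodE i gi _ (kH _ Hd); rewrite kK // => E.
  apply: (@lat_unit _ (edges (k (lift d)) (val e) * d i)).
  - by apply: lat_mul => //; apply: lat_sign.
  - apply: lat_mul; last by apply: lat_sign.
    exact: kL Hd (lift_inLat sd) (inl (val e)).
  - have Ed : d i = c * edges (k (lift d)) (val e) by [].
    by rewrite mulrA -Ed sign1_sqr //; apply: signvec_neq0.
(* Pass from [i] to the representative of its C1-set, at the cost of another sign. *)
have [_ h2 _] := hR'; have [r' r'R sc] := h2 i ni.
have [c2 c21 c2E] := same_cycles_flow sc ni.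
have r'E x : inH1 x -> edges (h x) r' = (c2 * c) * edges x (val e).
  move=> Hx; rewrite (c2E (edges (h x))); last by apply/inH1E; apply: hH.
  by rewrite goodE // mulrA.
exists (exist _ r' r'R); exists (c2 * c); first exact: sign1M.
split=> //; rewrite -S0.
have nr' : ~ separating r' by have [h1 _ _] := hR'; apply: h1.
have hvr : sign1 (hv r').
  by rewrite /hv r'E //; apply: sign1M => //; apply: sign1M.
apply: etrans (_ : l3 (exist _ r' r'R : E3 Rp') = _); first by [].
rewrite /l3; apply: etrans (esym (class_sum cC' nr' fhv hvr)) _; apply: eq_bigl => f'.
apply: eq_pbool; split=> [good x Hx xe|good x fx xr].
  by apply: (good (edges (h x))); [apply/inH1E; apply: hH | rewrite r'E // xe mulr0].
have Hx := lift_inH1 fx; have := good _ (kH _ Hx); rewrite kK //; apply.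
have := r'E _ (kH _ Hx); rewrite kK // [edges (lift x) r']xr => /esym/eqP.
by rewrite mulf_eq0 (negPf (sign1_neq0 (sign1M c21 c1))) => /eqP.
Qed.
End Torelli.

(** The matchings chosen in the two directions are inverse to each other: a round trip gives a
    representative with a proportional coordinate, which lies in the same C1-set and hence is the
    same edge. *)
Lemma jac_signed_iso (C C' : tgraph) (Rp : {set tE C}) (Rp' : {set tE C'}) :
  graph_connected C -> graph_connected C' ->
  (forall e : tE C, 0 < tl C e) -> (forall e : tE C', 0 < tl C' e) ->
  is_rep Rp -> is_rep Rp' -> jac_iso C C' -> signed_iso (conn3 Rp) (conn3 Rp').
Proof.
move=> cC cC' l0 l0' hR hR' /jac_isoP [h [k [hj kj hK kK]]].
have [_ hH _ _] := hj; have [_ kH _ _] := kj.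
have [phi phiP] := boolp.choice (edge_match cC cC' l0 l0' hR hR' hj kj hK kK).
have [psi psiP] := boolp.choice (edge_match cC' cC l0' l0 hR' hR kj hj kK hK).
have ex e : exists c : R, sign1 c /\
    forall x, inH1 x -> edges (h x) (val (phi e)) = c * edges x (val e).
  by have [c c1 [H _]] := phiP e; exists c.
have [eps epsP] := boolp.choice ex.
have same (D : tgraph) (Q : {set tE D}) (a b : E3 Q) (c : R) : is_rep Q -> sign1 c ->
    (forall x : jvec D, inH1 x -> edges x (val b) = c * edges x (val a)) -> a = b.
  move=> [_ _ u] c1 H; apply: val_inj; apply: u; rewrite ?(valP a) ?(valP b) //.
  apply: (@flow_same_cycles _ _ _ c); first exact: sign1_neq0.
  by move=> x fx; apply: (H (lift x)); apply: lift_inH1.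
have K1 : cancel phi psi.
  move=> e; have [c c1 [H _]] := phiP e; have [c' c1' [H' _]] := psiP (phi e).
  apply/esym/(same _ _ _ _ (c' * c) hR); first exact: sign1M.
  by move=> x Hx; have := H' _ (hH _ Hx); rewrite hK // => ->; rewrite H // mulrA.
have K2 : cancel psi phi.
  move=> e; have [c c1 [H _]] := psiP e; have [c' c1' [H' _]] := phiP (psi e).
  apply/esym/(same _ _ _ _ (c' * c) hR'); first exact: sign1M.
  by move=> x Hx; have := H' _ (kH _ Hx); rewrite kK // => ->; rewrite H // mulrA.
exists phi, psi, eps; split=> //.
- by move=> e; have [c _ []] := phiP e.
- by move=> e; have [] := epsP e.
- move=> y'; split=> fy.
    have [x' fx' <-] := res_surj fy; have Hx := lift_inH1 fx'.
    have : flow (res (Rp := Rp) (edges (k (lift x')))) by apply: res_flow; apply/inH1E; apply: kH.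
    congr flow; apply/funext=> e; have [s E] := epsP e; have := E _ (kH _ Hx); rewrite kK // => E'.
    have -> : res x' (phi e) = edges (lift x') (val (phi e)) by [].
    by rewrite E' mulrA sign1_sqr ?mul1r.
  have [x fx xE] := res_surj fy; have Hx := lift_inH1 fx.
  have : flow (res (Rp := Rp') (edges (h (lift x)))) by apply: res_flow; apply/inH1E; apply: hH.
  congr flow; apply/funext=> e'; rewrite -(K2 e'); set e := psi e'; have [s E] := epsP e.
  have -> : res (edges (h (lift x))) (phi e) = edges (h (lift x)) (val (phi e)) by [].
  rewrite E //; have -> : edges (lift x) (val e) = res x e by [].
  by rewrite xE mulrA sign1_sqr ?mul1r.
Qed.

(** * Signed isomorphisms induce isometries of Jacobians *)

Definition flow_map (C C' : tgraph) (H : (tE C -> R) -> (tE C' -> R)) : Prop :=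
  [/\ forall x, flow x -> flow (H x),
      forall x y c, flow x -> flow y -> H (fun e => x e + c * y e) = fun e => H x e + c * H y e,
      forall x, flow x -> (forall e, exists z : Z, x e = IZR z) ->
                forall e, exists z : Z, H x e = IZR z &
      forall x, flow x -> \sum_e H x e * H x e * tl C' e = \sum_e x e * x e * tl C e].

(** Restriction identifies the flows of a curve with those of its 3-edge-connectivization, and [H]
    is the signed isomorphism seen through it. Integrality survives because every edge coordinate is
    0 or a representative's coordinate up to sign. *)
Lemma signed_iso_flow_map (C C' : tgraph) (Rp : {set tE C}) (Rp' : {set tE C'}) phi psi eps :
  graph_connected C -> graph_connected C' -> is_rep Rp -> is_rep Rp' ->
  @signed_iso_by (conn3 Rp) (conn3 Rp') phi psi eps ->
  exists2 H, flow_map H &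
    forall x, flow x -> forall e, res (Rp := Rp') (H x) (phi e) = eps e * res (Rp := Rp) x e.
Proof.
move=> cC cC' hR hR' [[K1 K2] ll se fl].
have ex x : exists x', flow x -> flow x' /\
    forall e, res (Rp := Rp') x' (phi e) = eps e * res (Rp := Rp) x e.
  have [fx|nfx] := boolp.EM (flow x); last by exists (fun=> 0).
  pose y' e' := eps (psi e') * res (Rp := Rp) x (psi e').
  have fy : flow y'.
    apply/fl; have := res_flow (Rp := Rp) fx; congr flow; apply/funext=> e.
    by rewrite /y' K1 mulrA sign1_sqr ?mul1r.
  have [x' fx' x'E] := res_surj fy.
  by exists x' => _; split=> // e; rewrite x'E /y' K1.
have [H HP] := boolp.choice ex.
have Hf x : flow x -> flow (H x) by move=> /HP [].
have HE x : flow x -> forall e, res (Rp := Rp') (H x) (phi e) = eps e * res (Rp := Rp) x e.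
  by move=> /HP [].
have HE' x e' : flow x -> res (Rp := Rp') (H x) e' = eps (psi e') * res (Rp := Rp) x (psi e').
  by move=> fx; rewrite -{1}(K2 e') HE.
exists H => //; split=> //.
- move=> x y c fx fy; have fxy := (flow_lin C).2 x y c fx fy.
  apply: (res_inj cC' hR').
  + exact: Hf.
  + by apply: (flow_lin C').2; apply: Hf.
  + apply/funext=> e'; rewrite HE' //.
    have -> : res (fun e => H x e + c * H y e) e' = res (H x) e' + c * res (H y) e' by [].
    rewrite !HE' // /res; ring.
- move=> x fx zx e'; have [h|[r [c c1 h]]] := rep_coef cC' hR' e'.
    by rewrite h; [exists Z0|apply: Hf].
  rewrite h; last exact: Hf.
  have -> : H x (val r) = res (H x) r by [].
  rewrite HE' //; apply: lat_mul; first by apply: lat_sign; right.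
  by apply: lat_mul; [apply: lat_sign; right|apply: zx].
- move=> x fx; rewrite (Q_res cC' hR' (Hf x fx)) (Q_res cC hR fx).
  rewrite (reindex phi) /=; last by exists psi => e _; rewrite ?K1 ?K2.
  apply: eq_bigr => e _; rewrite HE // mulrACA sign1_sqr ?mul1r //; congr (_ * _).
  exact: ll.
Qed.

(** The inverse flow maps give equal Betti numbers; with the common genus the total weights agree,
    and the weight coordinates are identified by index. *)
Lemma signed_iso_jac (g : nat) (C C' : tgraph) (Rp : {set tE C}) (Rp' : {set tE C'}) :
  is_tcurve g C -> is_tcurve g C' -> is_rep Rp -> is_rep Rp' ->
  signed_iso (conn3 Rp) (conn3 Rp') -> jac_iso C C'.
Proof.
move=> [cC _ gC _] [cC' _ gC' _] hR hR' [phi [psi [eps SI]]].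
have SI' := signed_iso_by_sym SI; have [[K1 K2] _ se _] := SI.
have [H [Hf Hl Hz HQ] HE] := signed_iso_flow_map cC cC' hR hR' SI.
have [G [Gf Gl Gz GQ] GE] := signed_iso_flow_map cC' cC hR' hR SI'.
have GH x : flow x -> G (H x) = x.
  move=> fx; apply: (res_inj cC hR) => //; first by apply/Gf/Hf.
  apply/funext=> e; have := GE _ (Hf _ fx) (phi e); rewrite K1 => ->.
  by rewrite HE // mulrA sign1_sqr ?mul1r.
have HG y : flow y -> H (G y) = y.
  move=> fy; apply: (res_inj cC' hR') => //; first by apply/Hf/Gf.
  apply/funext=> e'; have := HE _ (Gf _ fy) (psi e'); rewrite K2 => ->.
  by rewrite GE // mulrA sign1_sqr ?mul1r.
have inj0 (D D' : tgraph) (A : (tE D -> R) -> (tE D' -> R)) B : flow_map A ->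
    (forall x, flow x -> B (A x) = x) -> forall x, flow x -> A x = (fun=> 0) -> x = fun=> 0.
  move=> [_ Al _ _] BA x fx Ax; have f0 := (flow_lin D).1.
  have E0 : (fun e : tE D => GRing.add 0 (-1 * 0)) = (fun=> GRing.zero) :> (tE D -> R).
    by apply/funext=> e; rewrite mulr0 addr0.
  have A0 : A (fun=> 0) = fun=> 0.
    have h := Al _ _ (-1) f0 f0; rewrite E0 in h; apply/funext=> e.
    by have := congr1 (fun u => u e) h; rewrite /= => h'; lra.
  by rewrite -(BA x fx) Ax -A0 BA.
have b1E : b1 C = b1 C'.
  apply/eqP; rewrite eqn_leq; apply/andP; split.
    by apply: (b1_le (h := H)) => //; apply: inj0 GH.
  by apply: (b1_le (h := G)) => //; apply: inj0 HG.
have wE : totw C = totw C' by lia.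
pose h (x : jvec C) : jvec C' := fun j =>
  match j with inl e => H (edges x) e | inr i => x (inr (cast_ord (esym wE) i)) end.
pose k (x : jvec C') : jvec C := fun j =>
  match j with inl e => G (edges x) e | inr i => x (inr (cast_ord wE i)) end.
apply/jac_isoP; exists h, k; split.
- split.
  + move=> x y c Hx Hy; apply/funext=> -[e|i] //=.
    by have := Hl _ _ c (proj1 (inH1E x) Hx) (proj1 (inH1E y) Hy) => /(congr1 (fun u => u e)).
  + by move=> x Hx; apply/inH1E; apply: Hf; apply/inH1E.
  + move=> x Hx Lx [e|i] /=; last exact: Lx.
    by apply: Hz; [apply/inH1E|move=> f; apply: Lx].
  + by move=> x Hx; rewrite !QformE; apply: HQ; apply/inH1E.
- split.
  + move=> x y c Hx Hy; apply/funext=> -[e|i] //=.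
    by have := Gl _ _ c (proj1 (inH1E x) Hx) (proj1 (inH1E y) Hy) => /(congr1 (fun u => u e)).
  + by move=> x Hx; apply/inH1E; apply: Gf; apply/inH1E.
  + move=> x Hx Lx [e|i] /=; last exact: Lx.
    by apply: Gz; [apply/inH1E|move=> f; apply: Lx].
  + by move=> x Hx; rewrite !QformE; apply: GQ; apply/inH1E.
- move=> x Hx; apply/funext=> -[e|i] /=; last by congr (x (inr _)); apply: val_inj.
  have -> : edges (h x) = H (edges x) by [].
  by rewrite GH //; apply/inH1E.
- move=> y Hy; apply/funext=> -[e|i] /=; last by congr (y (inr _)); apply: val_inj.
  have -> : edges (k y) = G (edges y) by [].
  by rewrite HG //; apply/inH1E.
Qed.

(** * 3-connected graphs *)

Section ThreeConnected.
Variable C : tgraph.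
Hypotheses (cC : graph_connected C) (tC : three_connected C) (lC : loopless C).

Lemma joinsC e (a b : tV C) : joins e a b = joins e b a.
Proof. by rewrite /joins orbC. Qed.

Lemma adj_in_connect_sym (P : pred (tE C)) (Vok : pred (tV C)) : connect_sym (adj_in P Vok).
Proof.
apply: sym_connect_sym => a b; rewrite /adj_in andbCA.
by congr [&& _, _ & _]; apply: eq_existsb => e; rewrite joinsC.
Qed.

(** Given a fourth vertex [z], deleting [v] and [z] already leaves [u] and [w] connected. With only
    the three vertices [b], [v], [w] and [b] a cut vertex, [v] and [w] are not adjacent, so
    connectedness makes [w] adjacent to [b]. *)
Lemma noncut_vertices : exists b, forall v, v != b -> connected_on (C := C) predT (predC1 v).
Proof.
have [[b nb]|h] := boolp.EM (exists b, ~ connected_on (C := C) predT (predC1 b)); last first.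
  have [/card_gt0P [b _] _] := cC; exists b => v _; apply: contrapT => nv; apply: h; exists v.
  exact: nv.
have [x [y [xb yb nxy]]] : exists x y, [/\ x != b, y != b & ~ connect (adj_in predT (predC1 b)) x y].
  apply: contrapT => h; apply: nb => x y xb yb; apply: contrapT => nc; apply: h.
  by exists x, y.
have xy : x != y by apply: contra_notN nxy => /eqP ->; apply: connect0.
have small v w : v != b -> w != v -> w != b -> (forall z, [|| z == b, z == v | z == w]) ->
    connect (adj_in predT (predC1 v)) b w.
  move=> vb wv wb all3.
  have nvw : ~ connect (adj_in predT (predC1 b)) v w.
    move=> c; apply: nxy; have := all3 x; have := all3 y; rewrite (negPf xb) (negPf yb) /=.
    case/orP=> /eqP yE /orP [] /eqP xE; move: xy; rewrite xE yE ?eqxx // => _.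
    by rewrite adj_in_connect_sym.
  apply: contrapT => nbw.
  have := @pot_const C predT predT _ (fun u => u == w) w b; rewrite eqxx eq_sym (negPf wb).
  suff H : forall e, (ttgt C e == w) = (tsrc C e == w).
    by move=> /(_ (fun e _ _ _ => H e)) /(_ (cC.2 w b isT isT)).
  have key e o : joins e w o -> o != w -> False.
    move=> j ow; have := all3 o; rewrite (negPf ow) orbF => /orP [] /eqP oE.
      apply: nbw; rewrite adj_in_connect_sym; apply: connect1; apply/and3P; split=> //=.
        by rewrite eq_sym.
      by apply/existsP; exists e; rewrite -oE.
    apply: nvw; rewrite adj_in_connect_sym; apply: connect1; apply/and3P; split=> //=.
    by apply/existsP; exists e; rewrite -oE.
  move=> e; have [t|t] := eqVneq (ttgt C e) w; have [s|s] := eqVneq (tsrc C e) w => //.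
    by exfalso; apply: (key e (tsrc C e)) => //; rewrite /joins t !eqxx orbT.
  by exfalso; apply: (key e (ttgt C e)) => //; rewrite /joins s !eqxx.
exists b => v vb u w uv wv; have [->|uw] := eqVneq u w; first exact: connect0.
have [z /and3P [zu zw zv]|all3] := pickP (fun z => [&& z != u, z != w & z != v]).
  apply: (connect_sub _ (tC (_ : v != z) _ _)); rewrite 1?eq_sym //; last 2 first.
  - by apply/andP; split=> //; rewrite eq_sym.
  - by apply/andP; split=> //; rewrite eq_sym.
  move=> a c /and3P [/andP [av _] /andP [cv _] j]; apply: connect1.
  by apply/and3P.
have bw : b = u \/ b = w.
  have := all3 b; rewrite [b == v]eq_sym (negPf vb) andbT.
  by have [->|] := eqVneq b u; [left|have [->|] := eqVneq b w; [right|]].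
have all z : [|| z == u, z == w | z == v].
  by have := all3 z; case: (z == u); case: (z == w); case: (z == v).
case: bw => bE; subst b.
  apply: small => //; first by rewrite eq_sym.
  by move=> z; have := all z; case: (z == u); case: (z == w); case: (z == v).
rewrite adj_in_connect_sym; apply: small => //.
by move=> z; have := all z; case: (z == u); case: (z == w); case: (z == v).
Qed.

Definition incident (v : tV C) (e : tE C) : bool := (tsrc C e == v) || (ttgt C e == v).

Lemma valence_le2 v e f : (forall g, incident v g -> g = e \/ g = f) -> (valence v <= 2)%N.
Proof.
move=> H; rewrite /valence -cardsUI.
have -> : [set g | tsrc C g == v] :&: [set g | ttgt C g == v] = set0.
  apply/setP=> g; rewrite !inE; apply/negP=> /andP [/eqP s /eqP t].
  by have := lC g; rewrite s t eqxx.
rewrite cards0 addn0; apply: leq_trans (_ : #|[set e; f]| <= 2)%N; last by rewrite cards2; case: eqP.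
by apply/subset_leq_card/subsetP=> g; rewrite !inE => /H [] ->; rewrite eqxx ?orbT.
Qed.

Hypothesis vC : forall v : tV C, (3 <= valence v)%N.

(** Otherwise only [e] and [f] can leave the level set [X] of the source [a] of [e]. Pick [b2]
    outside [X], at an end of [f] if [f] crosses: deleting [a] and [b2] removes all crossing edges,
    against 3-connectedness, unless one side is a single vertex, whose valence is then at most 2.
    The case [e = f] covers bridges. *)
Lemma no_small_cut (T : eqType) (p : tV C -> T) e f :
  (forall g, g != e -> g != f -> p (ttgt C g) = p (tsrc C g)) -> p (ttgt C e) = p (tsrc C e).
Proof.
move=> pg; apply/eqP/negPn/negP=> pe.
pose a := tsrc C e; pose b := ttgt C e; pose X v := p v == p a.
have [b2 [nXb2 fb2]] : exists b2, ~~ X b2 /\ (X (tsrc C f) != X (ttgt C f) -> incident b2 f).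
  have [cf|_] := boolP (X (tsrc C f) != X (ttgt C f)); last by exists b.
  have [Xs|nXs] := boolP (X (tsrc C f)).
    exists (ttgt C f); split; first by move: cf; rewrite Xs; case: (X _).
    by rewrite /incident eqxx orbT.
  by exists (tsrc C f); rewrite nXs /incident eqxx.
have Xa : X a by rewrite /X.
have cross g : X (tsrc C g) != X (ttgt C g) -> g = e \/ g = f.
  have [->|ge] := eqVneq g e; first by left.
  by have [->|gf] := eqVneq g f; [right | rewrite /X pg // eqxx].
have cross2 g : X (tsrc C g) != X (ttgt C g) -> incident a g || incident b2 g.
  move=> cg; have [ge|gf] := cross g cg; first by rewrite ge /incident eqxx.
  by move: cg; rewrite gf => /fb2 ->; rewrite orbT.
have [z /andP [Xz za]|noz] := pickP (fun z => X z && (z != a)); last first.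
  have : (valence a <= 2)%N.
    apply: (@valence_le2 a e f) => g /orP [] /eqP ga; apply: cross.
      rewrite ga Xa; have := noz (ttgt C g); have := lC g; rewrite ga eq_sym => h.
      by rewrite h andbT => ->.
    rewrite ga Xa; have := noz (tsrc C g); have := lC g; rewrite ga => h.
    by rewrite h andbT => ->.
  by rewrite leqNgt ltnNge; have := vC a; case: (valence a) => [|[|[|n]]].
have [w /andP [Xw wb]|now] := pickP (fun w => ~~ X w && (w != b2)); last first.
  have : (valence b2 <= 2)%N.
    apply: (@valence_le2 b2 e f) => g /orP [] /eqP ga; apply: cross.
      rewrite ga (negPf nXb2); have := now (ttgt C g); have := lC g; rewrite ga eq_sym => h.
      by rewrite h andbT => /negbFE ->.
    rewrite ga (negPf nXb2); have := now (tsrc C g); have := lC g; rewrite ga => h.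
    by rewrite h andbT => /negbFE ->.
  by have := vC b2; case: (valence b2) => [|[|[|n]]].
have ab2 : a != b2 by apply: contraNneq nXb2 => <-.
have zok : (z != a) && (z != b2) by rewrite za; apply: contraNneq nXb2 => <-.
have wok : (w != a) && (w != b2) by rewrite wb andbT; apply: contraNneq Xw => ->.
have : X z = X w.
  apply: pot_const (tC ab2 zok wok) => g _ /andP [s1 s2] /andP [t1 t2].
  have [//|] := eqVneq (X (ttgt C g)) (X (tsrc C g)); rewrite eq_sym => /cross2.
  by rewrite /incident (negPf s1) (negPf s2) (negPf t1) (negPf t2).
by rewrite Xz (negPf Xw).
Qed.

Lemma three_connected_nonsep (e : tE C) : ~ separating e.
Proof.
move=> se; have [|p pE] := cut_pot cC (u := fun g => (e == g)%:R).
  move=> x fx; under eq_bigr do rewrite mulrC.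
  by rewrite sum_delta (sep_flow cC se fx).
have := @no_small_cut _ p e e; have := pE e; rewrite eqxx => pe1 H.
have /eqP : 1 = 0 :> R.
  apply: etrans pe1 _; rewrite H ?subrr // => g ge _; have := pE g.
  by rewrite eq_sym (negPf ge) => /esym/subr0_eq.
by rewrite oner_eq0.
Qed.

(** A relation [x f = c * x e] on flows is orthogonality to a vector supported on two edges, that
    is, a cut with two edges. *)
Lemma three_connected_same (e f : tE C) : same_cycles e f -> e = f.
Proof.
move=> sc; have [//|ef] := eqVneq e f.
have [c c1 cE] := same_cycles_flow sc (@three_connected_nonsep e).
have [|p pE] := cut_pot cC (u := fun g => (f == g)%:R - c * (e == g)%:R).
  move=> x fx; transitivity (\sum_g x g * (f == g)%:R - c * \sum_g x g * (e == g)%:R).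
    by rewrite mulr_sumr -sumrB; apply: eq_bigr => g _; ring.
  by rewrite !sum_delta cE // subrr.
have := @no_small_cut _ p e f; have := pE e; rewrite eqxx eq_sym (negPf ef) sub0r mulr1 => pe1 H.
have /eqP : - c = 0.
  apply: etrans pe1 _; rewrite H ?subrr // => g ge gf; have := pE g.
  by rewrite eq_sym (negPf gf) eq_sym (negPf ge) mulr0 subrr => /esym/subr0_eq.
by rewrite oppr_eq0 (negPf (sign1_neq0 c1)).
Qed.

Lemma three_connected_rep : is_rep (setT : {set tE C}).
Proof.
split=> [e _|e _|e f _ _]; [exact: three_connected_nonsep|by exists e|exact: three_connected_same].
Qed.
End ThreeConnected.

(** * When every C1-set is a single edge, the curve carries the flows and lengths of its
    connectivization *)

Section FullRep.
Variable C : tgraph.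
Hypothesis hR : is_rep (setT : {set tE C}).

Definition full_edge (e : tE C) : E3 (setT : {set tE C}) := exist _ e (in_setT e).

Lemma full_edgeK (e : E3 (setT : {set tE C})) : full_edge (val e) = e.
Proof. exact: val_inj. Qed.

Lemma flow_full (x : tE C -> R) : flow x <-> flow (res (Rp := setT) x).
Proof.
split=> [/res_flow //|/res_surj [x2 fx2 E]].
have <- // : x2 = x; apply/funext=> e; exact: (congr1 (fun u => u (full_edge e)) E).
Qed.

Lemma tl_full (e : tE C) : tl (conn3 (setT : {set tE C})) (full_edge e) = tl C e.
Proof.
have [h1 _ h3] := hR.
have -> : tl (conn3 setT) (full_edge e) =
  \sum_(f | pbool (~ separating f /\ same_cycles e f)) tl C f by [].
apply: big_pred1 => f; apply/pboolP/eqP=> [[_ sc]|->].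
  by apply/esym/h3; rewrite ?in_setT.
by split=> //; apply: h1; rewrite in_setT.
Qed.
End FullRep.

Lemma signed_iso_full (C C' : tgraph) :
  is_rep (setT : {set tE C}) -> is_rep (setT : {set tE C'}) ->
  signed_iso (conn3 (setT : {set tE C})) (conn3 (setT : {set tE C'})) -> signed_iso C C'.
Proof.
move=> hR hR' [phi [psi [eps [[K1 K2] ll se fl]]]].
exists (fun e => val (phi (full_edge e))), (fun e' => val (psi (full_edge e'))),
  (fun e => eps (full_edge e)); split=> //.
- by split=> e; rewrite full_edgeK ?K1 ?K2.
- by move=> e; rewrite -(tl_full hR') full_edgeK ll tl_full.
- move=> x; rewrite (flow_full x) fl (flow_full (fun e => eps (full_edge e) * x (val (phi (full_edge e))))).
  have -> // : res (fun e => eps (full_edge e) * x (val (phi (full_edge e)))) =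
    (fun e => eps e * res x (phi e)).
  by apply/funext=> e; rewrite /res full_edgeK.
Qed.

(** * Recovering the vertices from their stars *)

Section Whitney.
Variables (C C' : tgraph) (phi : tE C -> tE C') (psi : tE C' -> tE C) (eps : tE C -> R).
Hypotheses (cC : graph_connected C) (cC' : graph_connected C').
Hypotheses (lC : loopless C) (lC' : loopless C') (tC : three_connected C).
Hypotheses (vC : forall v : tV C, exists e, incident v e).
Hypotheses (vC' : forall v : tV C', exists e, incident v e).
Hypothesis SI : signed_iso_by phi psi eps.

Lemma incidentP (D : tgraph) (v : tV D) (e : tE D) : loopless D ->
  incident v e = ((ttgt D e == v)%:R - (tsrc D e == v)%:R != 0 :> R).
Proof.
move=> lD; have lDe := negPf (lD e); rewrite /incident.
have [s|s] := eqVneq (tsrc D e) v; have [t|t] := eqVneq (ttgt D e) v => /=.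
- by rewrite s t eqxx in lDe.
- by rewrite sub0r oppr_eq0 oner_neq0.
- by rewrite subr0 oner_neq0.
- by rewrite subrr eqxx.
Qed.

Lemma star_image v : connected_on (C := C) predT (predC1 v) ->
  exists v' : tV C', forall e, incident v e = incident v' (phi e).
Proof.
move=> cv; have [[K1 K2] _ se fl] := SI; have [_ _ se' fl'] := signed_iso_by_sym SI.
(* The star of [v] as a coboundary, transported to [C']: it stays orthogonal to flows, so it is the
   coboundary of a potential [p']. *)
pose u' e' := eps (psi e') * ((ttgt C (psi e') == v)%:R - (tsrc C (psi e') == v)%:R).
have [|p' p'E] := cut_pot cC' (u := u').
  move=> x' /fl fx; rewrite (reindex phi) /=; last by exists psi => e _; rewrite ?K1 ?K2.
  have /flowP /(_ (fun w => (w == v)%:R)) := fx; rewrite /pairing => E.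
  by apply: etrans E; apply: eq_bigr => e _; rewrite /u' K1; ring.
have u'0 e : (u' (phi e) != 0) = incident v e.
  by rewrite /u' K1 mulf_eq0 (negPf (sign1_neq0 (se e))) incidentP.
have p'0 e : ~~ incident v e -> p' (ttgt C' (phi e)) = p' (tsrc C' (phi e)).
  by rewrite -u'0 negbK p'E subr_eq0 => /eqP.
(* Otherwise every vertex of [C'] keeps an edge outside the cut, so the edges off the star of [v]
   split into two nonempty classes [EX] and [EY] by the side of [X] on which their images lie. *)
have [v' v'P] : exists v', forall e, incident v' (phi e) -> incident v e.
  apply: contrapT => no.
  have all0 w' : exists2 e, incident w' (phi e) & ~~ incident v e.
    apply: contrapT => h; apply: no; exists w' => e ie; apply/negPn/negP=> ne.
    by apply: h; exists e.
  have [e1 ie1] := vC v.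
  pose a' := tsrc C' (phi e1); pose X w' := p' w' == p' a'.
  have nXb : ~~ X (ttgt C' (phi e1)).
    by move: ie1; rewrite -u'0 p'E subr_eq0.
  pose EX e := ~~ incident v e && X (tsrc C' (phi e)).
  pose EY e := ~~ incident v e && ~~ X (tsrc C' (phi e)).
  have XE e w' : ~~ incident v e -> incident w' (phi e) -> X (tsrc C' (phi e)) = X w'.
    by move=> ne /orP [] /eqP <- //; rewrite /X p'0.
  have [eX0 EX0] : exists e, EX e.
    by have [e ie ne] := all0 a'; exists e; rewrite /EX ne (XE _ _ ne ie) /X eqxx.
  have [eY0 EY0] : exists e, EY e.
    by have [e ie ne] := all0 (ttgt C' (phi e1)); exists e; rewrite /EY ne (XE _ _ ne ie).
  (* In [C'] no edge off the cut joins [X] to its complement, so the part of a flow inside [X] is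
     again a flow. *)
  have splitX x : flow x -> (forall e, incident v e -> x e = 0) ->
      flow (fun e => if EX e then x e else 0).
    move=> fx x0; apply/fl'.
    have fx' p : pairing (fun e' => eps (psi e') * x (psi e')) p = 0.
      have /fl' /flowP := fx; exact.
    apply/flowP=> p; have := fx' (fun w => if X w then p w else 0); apply: etrans.
    apply: eq_bigr => e' _; rewrite -(K2 e'); move: (psi e') => e {e'}; rewrite !K1 /EX.
    have [ie|ne] := boolP (incident v e); first by rewrite x0 //= !mulr0 !mul0r.
    rewrite /= (XE e (ttgt C' (phi e))) //; last by rewrite /incident eqxx orbT.
    by case: ifP => _; rewrite ?subrr ?mulr0 ?mul0r.
  (* The graph without [v] is connected, so the two classes of edges meet at some vertex [z]. *)
  have [z [zv [eX [eY [EXX EYY zX zY]]]]] : exists z, z != v /\ exists eX eY,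
      [/\ EX eX, EY eY, incident z eX & incident z eY].
    apply: contrapT => noz.
    pose q w := [exists e, EX e && incident w e].
    have srcv e : ~~ incident v e -> (tsrc C e != v) /\ (ttgt C e != v).
      by rewrite /incident negb_or => /andP.
    have sY e w : EY e -> incident w e -> q w = false.
      move=> Ye iw; apply: negbTE; apply/negP=> h; have [f /andP [Xf iwf]] := existsP h; apply: noz; exists w; split.
        apply: contraTneq Ye => wv; by rewrite /EY -wv iw.
      by exists f, e.
    have : q (tsrc C eX0) = q (tsrc C eY0).
      have [neX _] := andP EX0; have [neY _] := andP EY0.
      apply: pot_const (cv _ _ (srcv _ neX).1 (srcv _ neY).1) => e _ s t.
      have ne : ~~ incident v e by rewrite /incident negb_or; apply/andP.
      have is_ : incident (tsrc C e) e by rewrite /incident eqxx.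
      have it : incident (ttgt C e) e by rewrite /incident eqxx orbT.
      have [Xe|Xe] := boolP (EX e).
        by transitivity true; [|symmetry]; apply/existsP; exists e; rewrite Xe.
      have Ye : EY e by move: Xe; rewrite /EX /EY ne.
      by rewrite !(sY e).
    rewrite (sY eY0 (tsrc C eY0)) //; last by rewrite /incident eqxx.
    by move=> /negbT; rewrite negb_exists => /forallP /(_ eX0); rewrite EX0 /incident eqxx.
  have other e : incident z e -> ~~ incident v e -> exists a, [/\ joins e z a, a != z & a != v].
    rewrite /incident negb_or => /orP [] /eqP ez /andP [s t].
      by exists (ttgt C e); rewrite /joins ez !eqxx t; have := lC e; rewrite ez eq_sym.
    by exists (tsrc C e); rewrite /joins ez !eqxx orbT s; have := lC e; rewrite ez.
  have [neX _] := andP EXX; have [neY nXY] := andP EYY.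
  have [a [ja az av]] := other eX zX neX; have [b [jb bz bv]] := other eY zY neY.
  have vz : v != z by rewrite eq_sym.
  have [|y ys yp] := @path_flow C predT (fun w => (w != v) && (w != z)) a b.
    by apply: tC => //; apply/andP.
  have [sa sa1 saE] := joins_sign ja; have [sb sb1 sbE] := joins_sign jb.
  (* A closed walk through [eX], [z] and [eY] that avoids [v], using a path that also avoids [z].
     Its restriction to [EX] has only [eX] at [z], so it is no flow, contrary to [splitX]. *)
  pose x e := (y e + sa * (eX == e)%:R) + (- sb) * (eY == e)%:R.
  have fx : flow x.
    by apply/flowP=> p; rewrite !pairingD yp !pairing_delta saE mulNr sbE; ring.
  have yinc e w : (w == v) || (w == z) -> incident w e -> y e = 0.
    move=> wvz iw; apply/eqP/negPn/negP=> /ys [_ /andP [s1 s2] /andP [t1 t2]].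
    by case/orP: wvz => /eqP wE; move: iw; rewrite wE /incident ?(negPf s1) ?(negPf s2) ?(negPf t1) ?(negPf t2).
  have x0 e : incident v e -> x e = 0.
    move=> ie; rewrite /x (yinc e v) ?eqxx //.
    have -> : (eX == e) = false by apply: contraNF neX => /eqP ->.
    have -> : (eY == e) = false by apply: contraNF neY => /eqP ->.
    by rewrite !mulr0 !addr0.
  have /flowP /(_ (fun w => (z == w)%:R)) := splitX x fx x0.
  rewrite /pairing (bigD1 eX) //= big1 => [|e eeX]; last first.
    have [iz|niz] := boolP (incident z e); last first.
      by move: niz; rewrite /incident negb_or !(eq_sym z) => /andP [/negPf -> /negPf ->]; rewrite subrr mulr0.
    case: ifP => [Xe|_]; last by rewrite mul0r.
    rewrite /x (yinc e z) ?eqxx ?orbT // [eX == e]eq_sym (negPf eeX).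
    have -> : (eY == e) = false.
      by apply: contraTF Xe => /eqP <-; move: EYY; rewrite /EX /EY => /andP [_ /negPf ->]; rewrite andbF.
    by rewrite !mulr0 !addr0 mul0r.
  rewrite EXX /x (yinc eX z) ?eqxx ?orbT //.
  have -> : (eY == eX) = false.
    by apply: contraTF EXX => /eqP <-; move: EYY; rewrite /EX /EY => /andP [_ /negPf ->]; rewrite andbF.
  rewrite mulr0 !addr0 add0r mulr1 (saE (fun w => (z == w)%:R)) eqxx eq_sym (negPf az).
  by rewrite sub0r => /eqP; rewrite oppr_eq0 oner_eq0.
exists v' => e; apply/idP/idP; last exact: v'P.
(* For the reverse inclusion the star of [v'] is carried back. Its potential is constant off [v] and
   changes along one edge at [v], hence along all of them. *)
pose u f := eps f * ((ttgt C' (phi f) == v')%:R - (tsrc C' (phi f) == v')%:R).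
have [|p pE] := cut_pot cC (u := u).
  move=> x fx; have := fx => /fl' /flowP /(_ (fun w => (w == v')%:R)); rewrite /pairing => E.
  apply: etrans E; rewrite [RHS](reindex phi) /=; last by exists psi => f _; rewrite ?K1 ?K2.
  by apply: eq_bigr => f _; rewrite K1 /u; ring.
have u0 f : (u f != 0) = incident v' (phi f).
  by rewrite /u mulf_eq0 (negPf (sign1_neq0 (se f))) incidentP.
have pc a b : a != v -> b != v -> p a = p b.
  move=> av bv; apply: pot_const (cv a b av bv) => f _ sv tv.
  have : ~~ incident v' (phi f).
    by apply/negP=> /v'P; rewrite /incident (negPf sv) (negPf tv).
  by rewrite -u0 negbK pE subr_eq0 => /eqP.
have [f' if'] := vC' v'; have := if'; rewrite -(K2 f') => if''.
have ivf := v'P _ if''.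
have pI g o : o != v -> incident v g -> (p (ttgt C g) == p (tsrc C g)) = (p v == p o).
  move=> ov /orP [] /eqP gv; have lg := lC g; rewrite gv.
    by rewrite (pc (ttgt C g) o) ?[p o == _]eq_sym // -gv eq_sym.
  by rewrite (pc (tsrc C g) o) // -gv.
have [o ov] : exists o, o != v.
  have lf := lC (psi f'); case/orP: ivf => /eqP gv; rewrite -gv; first by exists (ttgt C (psi f')); rewrite eq_sym.
  by exists (tsrc C (psi f')).
by move=> ie; move: if''; rewrite -!u0 !pE !subr_eq0 !(pI _ o).
Qed.

(** Incidence with every vertex other than [b] is preserved, and since an edge has two distinct ends
    this settles incidence with [b] too. Two vertices with the same star would form a component
    without [b], hence injectivity. *)
Lemma whitney : #|tV C| = #|tV C'| ->
  exists2 sigma : tV C -> tV C', bijective sigma &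
    forall e, joins (phi e) (sigma (tsrc C e)) (sigma (ttgt C e)).
Proof.
move=> cardV; have [b nb] := noncut_vertices cC tC.
have ex v : exists v' : tV C', v != b -> forall e, incident v e = incident v' (phi e).
  have [->|vb] := eqVneq v b; last by have [v' v'P] := star_image (nb v vb); exists v'.
  by have [/card_gt0P [v' _] _] := cC'; exists v'.
have [s sP] := boolp.choice ex.
have sinj v w : v != b -> w != b -> s v = s w -> v = w.
  move=> vb wb svw; apply/eqP/negPn/negP=> vw.
  have inc e : incident v e = incident w e by rewrite !sP // svw.
  have := @pot_const C predT predT _ (fun u => (u == v) || (u == w)) v b.
  rewrite eqxx !(eq_sym b) (negPf vb) (negPf wb) => H.
  suff : true = false by []; apply: H (cC.2 v b isT isT) => e _ _ _.
  have := inc e; rewrite /incident.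
  have [xv|xv] := eqVneq (tsrc C e) v; first by rewrite xv (negPf vw) /= => <-; rewrite orbT.
  have [xw|xw] /= := eqVneq (tsrc C e) w; first by move=> ->.
  by have [yv|yv] := eqVneq (ttgt C e) v => /=; first by rewrite yv (negPf vw).
(* The images of the vertices other than [b] cannot exhaust a set of the same size as [tV C]; the
   vertex left over is assigned to [b]. *)
have [b' b'P] : exists b', forall v, v != b -> s v != b'.
  apply: contrapT => h.
  have : (#|tV C'| <= #|[set s v | v in predC1 b]|)%N.
    rewrite -cardsT; apply/subset_leq_card/subsetP=> w _; apply/imsetP; apply: contrapT => nw.
    by apply: h; exists w => v vb; apply: contra_notN nw => /eqP <-; exists v.
  move=> h1; have := leq_trans h1 (leq_imset_card s (predC1 b)); rewrite cardC1 -cardV.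
  by have [V0 _] := cC; rewrite leqNgt ltn_predL V0.
pose sigma v := if v == b then b' else s v.
have siginj : injective sigma.
  move=> v w; rewrite /sigma; case: eqP => [->|/eqP vb]; case: eqP => [->|/eqP wb] //.
  - by move=> /esym/eqP; rewrite (negPf (b'P w wb)).
  - by move=> /eqP; rewrite (negPf (b'P v vb)).
  - exact: sinj.
have sigbij : bijective sigma by apply: inj_card_bij => //; rewrite cardV.
exists sigma => // e; have [tau K1 K2] := sigbij.
have sE w : w != b -> incident w e = incident (sigma w) (phi e).
  by move=> wb; rewrite /sigma (negPf wb); apply: sP.
have := lC' (phi e); have := lC e; move: sE; rewrite /incident /joins.
move: (tsrc C e) (ttgt C e) => a c; rewrite -(K2 (tsrc C' (phi e))) -(K2 (ttgt C' (phi e))).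
move: (tau (tsrc C' (phi e))) (tau (ttgt C' (phi e))) => w1 w2 sE ac.
rewrite !(inj_eq siginj) => w12.
have {}sE w : w != b -> (a == w) || (c == w) = (w1 == w) || (w2 == w).
  by move=> /sE ->; rewrite !(inj_eq siginj).
have E1 := sE a; have E2 := sE c; have E3 := sE w1; have E4 := sE w2.
have [ab|ab] := eqVneq a b.
  have cb : c != b by rewrite -ab eq_sym.
  move: (E2 cb); rewrite eqxx orbT => /esym /orP [] /eqP wc; subst c.
    have [->|w2b] := eqVneq w2 b; first by rewrite ab !eqxx orbT.
    by move: (E4 w2b); rewrite eqxx orbT (negPf w12) orbF ab eq_sym (negPf w2b).
  have [->|w1b] := eqVneq w1 b; first by rewrite ab !eqxx.
  by move: (E3 w1b); rewrite eqxx [w2 == w1]eq_sym (negPf w12) orbF ab eq_sym (negPf w1b).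
move: (E1 ab); rewrite eqxx => /esym /orP [] /eqP wa; subst a.
  rewrite eqxx /=; have [cb|cb] := eqVneq c b.
    have [->|w2b] := eqVneq w2 b; first by rewrite cb eqxx.
    by move: (E4 w2b); rewrite eqxx orbT (negPf w12) cb eq_sym (negPf w2b).
  by move: (E2 cb); rewrite eqxx orbT (negPf ac) /= => <-.
rewrite eqxx andbT; apply/orP; right; have [cb|cb] := eqVneq c b.
  have [->|w1b] := eqVneq w1 b; first by rewrite cb eqxx.
  by move: (E3 w1b); rewrite eqxx [w2 == w1]eq_sym (negPf w12) cb eq_sym (negPf w1b).
by move: (E2 cb); rewrite eqxx orbT (negPf ac) orbF => <-.
Qed.
End Whitney.

Lemma three_connected_torelli (g : nat) (C C' : tgraph) :
  is_tcurve g C -> is_tcurve g C' -> three_connected C -> three_connected C' ->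
  loopless C -> loopless C' -> (forall v, tw C v = 0%N) -> (forall v, tw C' v = 0%N) ->
  jac_iso C C' -> tc_iso C C'.
Proof.
move=> [cC vC gC lC] [cC' vC' gC' lC'] tC tC' llC llC' wC wC' jac.
have l0 (e : tE C) : 0 < tl C e by apply/RltP; apply: lC.
have l0' (e : tE C') : 0 < tl C' e by apply/RltP; apply: lC'.
have v3 (v : tV C) : (3 <= valence v)%N by apply: vC; apply: wC.
have v3' (v : tV C') : (3 <= valence v)%N by apply: vC'; apply: wC'.
have hR := three_connected_rep cC tC llC v3; have hR' := three_connected_rep cC' tC' llC' v3'.
have [phi [psi [eps SI]]] :=
  signed_iso_full hR hR' (jac_signed_iso cC cC' l0 l0' hR hR' jac).
have inc (D : tgraph) (v : tV D) : (3 <= valence v)%N -> exists e, incident v e.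
  move=> h; apply: contrapT => no; move: h; rewrite /valence.
  have n e : incident v e = false by apply/negP=> ie; apply: no; exists e.
  rewrite !eq_card0 // => e; have := n e; rewrite !inE /incident; case: eqP => //=; by case: eqP.
have [[K1 K2] ll _ _] := SI.
have EE : #|tE C| = #|tE C'| by apply: bij_eq_card; exists psi.
(* With zero weights [b1] is the genus, so equal edge numbers give equal vertex numbers. *)
have VV : #|tV C| = #|tV C'|.
  have t0 : totw C = 0%N by rewrite /totw big1.
  have t0' : totw C' = 0%N by rewrite /totw big1.
  have := card_V_le cC; have := card_V_le cC'; move: gC gC'; rewrite /b1 t0 t0' EE; lia.
have [sigma sb sj] := whitney cC cC' llC llC' tC (fun v => inc _ v (v3 v)) (fun v => inc _ v (v3' v)) SI VV.
exists sigma, phi; split=> //; first by exists psi.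
by move=> v; rewrite wC wC'.
Qed.

Theorem mainTheorem12 (g : nat) :
  (forall (C C' : tgraph), is_tcurve g C -> is_tcurve g C' ->
     forall (Rp : {set tE C}) (Rp' : {set tE C'}), is_rep Rp -> is_rep Rp' ->
       (jac_iso C C' <-> two_iso (conn3 Rp) (conn3 Rp'))) /\
  (forall (C C' : tgraph), is_tcurve g C -> is_tcurve g C' ->
     three_connected C -> three_connected C' ->
     loopless C -> loopless C' ->
     (forall v, tw C v = 0%N) -> (forall v, tw C' v = 0%N) ->
     jac_iso C C' -> tc_iso C C').
Proof.
split=> [C C' tcC tcC' Rp Rp' hR hR'|]; last exact: three_connected_torelli.
rewrite two_isoP; split; last exact: signed_iso_jac tcC tcC' hR hR'.
have [cC _ _ lC] := tcC; have [cC' _ _ lC'] := tcC'.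
have l0 (e : tE C) : 0 < tl C e by apply/RltP; apply: lC.
have l0' (e : tE C') : 0 < tl C' e by apply/RltP; apply: lC'.
exact: jac_signed_iso cC cC' l0 l0' hR hR'.
Qed.
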